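(* Let $n,k\in\mathbb{N}$ with $2\le n\le k+1$. Let $X_1,\dots,X_n$ be independent standard Gaussian random vectors in $\mathbb{R}^k$ and let $\mathcal{P}_n:=\operatorname{conv}(X_1,\dots,X_n)$ be the Gaussian simplex. Let $\Delta_n:=\operatorname{conv}(e_1,\dots,e_n)\subset\mathbb{R}^n$, where $e_1,\dots,e_n$ is the standard orthonormal basis of $\mathbb{R}^n$, be a regular simplex with $n$ vertices. Then for all $\ell\in\{0,\dots,n-2\}$ and $j\in\{0,\dots,n-2\}$, $$\mathbb{E}\,S_{\ell,j}(\mathcal{P}_n)=S_{\ell,j}(\Delta_n).$$
   Context: For a polytope $P\subset\mathbb{R}^d$, $\mathcal{F}_\ell(P)$ denotes the set of its $\ell$-dimensional faces. The tangent cone of $P$ at a face $F\in\mathcal{F}_\ell(P)$ is $T(F,P):=\{y\in\mathbb{R}^d:\exists\,\varepsilon>0\text{ such that } f_0+\varepsilon y\in P\}$, where $f_0$ is any point in the relative interior of $F$. For a convex cone $D\subset\mathbb{R}^d$ (a non-empty set closed under linear combinations with non-negative coefficients) and $j\in\{0,\dots,d\}$, the $j$-th Grassmann angle is $\gamma_j(D):=\mathbb{P}[D\cap W_{d-j}\neq\{0\}]$, where $W_{d-j}$ is a random $(d-j)$-dimensional linear subspace of $\mathbb{R}^d$ uniformly distributed (Haar measure) on the Grassmannian of all such subspaces. The sum of the $j$-th Grassmann angles at the $\ell$-dimensional faces of $P$ is $$S_{\ell,j}(P):=\sum_{F\in\mathcal{F}_\ell(P)}\gamma_j(T(F,P)).$$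 For the random polytope $\mathcal{P}_n$ these quantities are evaluated at its realization (in ambient space $\mathbb{R}^k$). *)

(* Defs.v *)
From HB Require Import structures.
From mathcomp Require Import all_boot all_order all_algebra.
From mathcomp Require Import all_classical all_reals all_analysis.
Set Implicit Arguments.
Unset Strict Implicit.
Unset Printing Implicit Defensive.
Import Order.TTheory GRing.Theory Num.Theory.
Import numFieldNormedType.Exports.
Local Open Scope classical_set_scope.
Local Open Scope ring_scope.

Section Polytopes.
Context {R : realType} {d : nat}.
Implicit Types (x y u : 'rV[R]_d) (A F P : set 'rV[R]_d).

Definition dotv u x : R := \sum_(i < d) u 0 i * x 0 i.

Definition conv_hull (n : nat) (p : 'I_n -> 'rV[R]_d) : set 'rV[R]_d :=
  [set x | exists a : 'I_n -> R,
    [/\ forall i, 0 <= a i, \sum_(i < n) a i = 1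
      & x = \sum_(i < n) a i *: p i]].

Definition aff_hull A : set 'rV[R]_d :=
  [set x | exists (m : nat) (a : 'I_m -> R) (p : 'I_m -> 'rV[R]_d),
    [/\ forall i, A (p i), \sum_(i < m) a i = 1
      & x = \sum_(i < m) a i *: p i]].

Definition has_affdim A (l : nat) : Prop :=
  exists (x0 : 'rV[R]_d) (L : {vspace 'rV[R]_d}),
    \dim L = l /\ aff_hull A = [set x | x - x0 \in L].

Definition relint A : set 'rV[R]_d :=
  [set x | A x /\ \forall y \near x, aff_hull A y -> A y].

(* The set where a linear functional attains its maximum over [P]; [u = 0]
   gives [P] itself (with [c = 0]) and the empty set. *)
Definition is_face P F : Prop :=
  exists (u : 'rV[R]_d) (c : R),
    (forall x, P x -> dotv u x <= c) /\ F = [set x | P x /\ dotv u x = c].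

(* The empty face belongs to no [faces l P], since its affine hull is empty. *)
Definition faces (l : nat) P : set (set 'rV[R]_d) :=
  [set F | is_face P F /\ has_affdim F l].

(* For a face of a convex set the condition on [y] does not depend on the
   point [f0] of the relative interior, so that quantifying [f0] existentially
   is the same as fixing it. *)
Definition tangent_cone F P : set 'rV[R]_d :=
  [set y | exists (f0 : 'rV[R]_d) (e : R),
    [/\ relint F f0, 0 < e & P (f0 + e *: y)]].

End Polytopes.

Section Borel.
Context (T : ptopologicalType).
Definition borel := g_sigma_algebraType (@open T).
HB.instance Definition _ := Measurable.on borel.
End Borel.

Section Grassmannian.
Context (R : realType) (d : nat).

HB.instance Definition _ := isPointed.Build {vspace 'rV[R]_d} 0%VS.

Definition open_hits : set (set {vspace 'rV[R]_d}) :=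
  [set [set W : {vspace 'rV[R]_d} | exists2 x, U x & x \in W]
    | U in @open 'rV[R]_d].

(* All linear subspaces of R^d, with the sigma-algebra generated by the events
   "W meets U", U open. On the subspaces of a fixed dimension m it is the Borel
   sigma-algebra of the Grassmannian. A random m-dimensional subspace is
   a probability on this type for which almost every W has dimension m; working
   with all dimensions at once keeps the type inhabited for every m. *)
Definition lin_subspace := g_sigma_algebraType open_hits.
HB.instance Definition _ := Measurable.on lin_subspace.

Definition rotate (Q : 'M[R]_d) (W : lin_subspace) : lin_subspace :=
  (linfun (mulmxr Q) @: (W : {vspace 'rV[R]_d}))%VS.

Definition uniform_law (m : nat) (mu : probability lin_subspace R) : Prop :=
  mu [set W : lin_subspace | \dim W = m] = 1%E /\
  forall Q : 'M[R]_d, Q *m Q^T = 1%:M ->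
  forall B : set lin_subspace, measurable B -> mu (rotate Q @^-1` B) = mu B.

(* For m <= d there is such a probability, unique on measurable sets. *)
Definition haar (m : nat) : probability lin_subspace R :=
  [get mu | uniform_law m mu].

End Grassmannian.

(* The event is measurable whenever the cone [D] is closed, in particular for
   tangent cones of polytopes. *)
Definition grassmann_angle {R : realType} {d : nat} (j : nat)
    (D : set 'rV[R]_d) : R :=
  fine (haar R d (d - j) [set W : lin_subspace R d | D `&` [set` W] <> [set 0]]).

Definition angle_sum {R : realType} {d : nat} (l j : nat)
    (P : set 'rV[R]_d) : R :=
  \sum_(F \in faces l P) grassmann_angle j (tangent_cone F P).

Section RandomVectors.
Context {R : realType} {d : measure_display} {T : measurableType d}.
Variable P : probability T R.

Definition independent (I : finType) (d' : measure_display)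
    (T' : measurableType d') (X : I -> T -> T') : Prop :=
  forall B : I -> set T', (forall i, measurable (B i)) ->
    P (\bigcap_i (X i @^-1` B i)) = (\prod_(i : I) P (X i @^-1` B i))%E.

(* The laws are compared on measurable sets only: on other sets the values of
   a [probability] are meaningless. *)
Definition std_gaussian (k : nat) (X : T -> 'rV[R]_k) : Prop :=
  (forall (c : 'I_k) (B : set R), measurable B ->
     P [set w | B (X w 0 c)] = normal_prob 0 1 B) /\
  independent (fun (c : 'I_k) w => X w 0 c).

End RandomVectors.

(* Main.v *)
Require Import Defs.
From HB Require Import structures.
From mathcomp Require Import all_boot all_order all_algebra.
From mathcomp Require Import all_classical all_reals all_analysis.
From mathcomp Require Import measurable_realfun.
From mathcomp Require Import ring.
Import Order.TTheory GRing.Theory Num.Theory.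
Import numFieldNormedType.Exports.
Set Implicit Arguments.
Unset Strict Implicit.
Unset Printing Implicit Defensive.
Local Open Scope classical_set_scope.
Local Open Scope ring_scope.

(* Write X for the matrix with rows X_1, ..., X_n and T_I for the tangent cone of
   Delta_n at the face with vertex set I, so that the tangent cone of P_n at the
   corresponding face is the image of T_I under a |-> a X, almost surely injective
   on the hyperplane of vectors with coordinate sum 0. A uniform subspace of R^k of
   codimension j is the kernel {x | x A = 0} of a Gaussian k x j matrix A. The cone
   T_I X meets it nontrivially iff a (X A) = 0 for some nonzero a in T_I. For fixed
   A of rank j, factor A = Q C with Q having orthonormal columns and C invertible;
   then X A and X Q have the same left kernel, and X Q is a Gaussian n x j matrix.
   By Fubini the expected Grassmann angle of T_I X is the probability that the
   kernel of a Gaussian n x j matrix meets T_I nontrivially, which is the Grassmann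
   angle of T_I in R^n.

   That kernels of Gaussian matrices realise the uniform law rests on the
   uniqueness of that law: averaging an invariant law over the Gram-Schmidt
   orthogonalisation of an independent Gaussian matrix turns it into the law of a
   randomly rotated fixed subspace. *)

(** * Borel sets of matrices *)

(** Since [haar] is a [get], nothing is known about it until some [uniform_law] has been exhibited:
    the kernels of Gaussian matrices serve both as existence proof and as explicit formula. The
    uniqueness argument needs a measurable source of orthogonal matrices that commutes with
    rotations; Gram-Schmidt on a Gaussian matrix is equivariant, and orthogonal almost surely.
    Invariance of Gaussian matrices under the orthogonal group is reduced to reflections of two
    entries, hence to the planar normal law. Measurability of the hitting events rests on
    compactness: a closed cone is met away from 0 iff its unit vectors are met, and these form a
    compact set. The combinatorial description of faces and tangent cones is available only for
    affinely independent points. The random angle sum is therefore known only off a null set, and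
    the final integral must cope with an integrand whose measurability is not established. *)

Lemma bigcup_countType_measurable d (T : measurableType d) (I : countType)
    (D : set I) (F : I -> set T) :
  (forall i, D i -> measurable (F i)) -> measurable (\bigcup_(i in D) F i).
Proof.
move=> mF.
have -> : \bigcup_(i in D) F i =
    \bigcup_n (if unpickle n is Some i then [set t | D i /\ F i t] else set0).
  apply/seteqP; split => [t [i Di Fit]|t [n _]].
    by exists (pickle i) => //; rewrite pickleK.
  by case: unpickle => // i [Di Fit]; exists i.
apply: bigcupT_measurable => n; case: unpickle => [i|//].
have [Di|nDi] := pselect (D i).
  rewrite (_ : [set t | _] = F i); first exact: mF.
  by apply/seteqP; split => [t []|t Ft].
by rewrite (_ : [set t | _] = set0)//; apply/seteqP; split => [t []|].
Qed.

Section RationalBalls.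
Context {R : realType} {m n : nat}.
Implicit Types (M N : 'M[R]_(m, n)) (c : 'M[rat]_(m, n) * nat).

(** Centre and radius range over a countable type, so unions of these balls stay measurable. The
    closed variant [rcball] supplies, for row vectors, compact sets inside open ones. *)
Definition rball c : set 'M[R]_(m, n) :=
  [set M | forall i j, `|ratr (c.1 i j) - M i j| < c.2.+1%:R^-1].

Definition rcball c : set 'M[R]_(m, n) :=
  [set M | forall i j, `|ratr (c.1 i j) - M i j| <= c.2.+1%:R^-1].

Lemma rball_open c : open (rball c).
Proof.
have -> : rball c = ball (map_mx ratr c.1 : 'M[R]_(m, n)) (c.2.+1%:R^-1).
  apply/seteqP; split => [M cM|M [_ cM] i j].
    split; first by rewrite invr_gt0.
    by move=> i j; have := cM i j; rewrite /ball/= mxE.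
  by have := cM i j; rewrite /ball/= mxE.
exact: ball_open.
Qed.

Lemma rball_sub c : rball c `<=` rcball c.
Proof. by move=> M cM i j; exact/ltW/cM. Qed.

Lemma rball_basis (U : set 'M[R]_(m, n)) M : open U -> U M ->
  exists2 c, rball c M & rcball c `<=` U.
Proof.
move=> oU UM; have /nbhs_ballP[e /= e0 eU] := open_nbhs_nbhs (conj oU UM).
have e20 : 0 < e / 2 by rewrite divr_gt0.
(* A radius below [e / 2] suffices: [M] and any [N] of the closed ball are both within that radius
   of the centre. *)
pose k := Num.truncn (e / 2)^-1.
have ke : k.+1%:R^-1 < e / 2.
  by rewrite invf_plt ?posrE// truncnS_gt.
have k0 : 0 < k.+1%:R^-1 :> R by rewrite invr_gt0.
have /all_sig2[q _ qM] : forall ij : 'I_m * 'I_n,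
    {q : rat | true & `|ratr q - M ij.1 ij.2| < k.+1%:R^-1}.
  move=> ij.
  have : M ij.1 ij.2 - k.+1%:R^-1 < M ij.1 ij.2 + k.+1%:R^-1 by rewrite ltrBlDr -addrA ltrDl addr_gt0.
  move=> /rat_in_itvoo/cid[q]; rewrite in_itv/= => /andP[q1 q2].
  by exists q => //; rewrite ltr_distl q1 q2.
exists (\matrix_(i, j) q (i, j), k) => [i j|N NM]; first by rewrite mxE (qM (i, j)).
apply: eU; split => // i j; rewrite /ball/=.
have := NM i j; have := qM (i, j); rewrite /= mxE => a b.
rewrite (_ : M i j - N i j = - (ratr (q (i, j)) - M i j) +
  (ratr (q (i, j)) - N i j)); last by ring.
rewrite (le_lt_trans (ler_normD _ _))// normrN.
by rewrite (splitr e) ltrD// ?(lt_trans a)// (le_lt_trans b).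
Qed.

Lemma open_bigcup_rball (U : set 'M[R]_(m, n)) : open U ->
  U = \bigcup_(c in [set c | rcball c `<=` U]) rball c.
Proof.
move=> oU; apply/seteqP; split => [M /(rball_basis oU)[c cM cU]|M [c cU /rball_sub]].
  by exists c.
exact: cU.
Qed.

End RationalBalls.

Lemma rcball_compact {R : realType} n (c : 'rV[rat]_n * nat) :
  compact (rcball c : set 'rV[R]_n).
Proof.
pose A j : set R := `[ratr (c.1 0 j) - c.2.+1%:R^-1,
                      ratr (c.1 0 j) + c.2.+1%:R^-1]%classic.
rewrite (_ : rcball c = [set v : 'rV[R]_n | forall j, A j (v ord0 j)]).
  by apply: rV_compact => j; exact: segment_compact.
apply/seteqP; split => [v cv j|v cv i j].
  by have := cv ord0 j; rewrite /A/= in_itv/= distrC ler_distl.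
by have := cv j; rewrite /A/= in_itv/= -ler_distl distrC (ord1 i).
Qed.

Section BorelMatrices.
Context {R : realType}.

Lemma borel_open (T : ptopologicalType) (U : set T) :
  open U -> measurable (U : set (borel T)).
Proof. exact: sub_sigma_algebra. Qed.

Lemma borel_closed (T : ptopologicalType) (U : set T) :
  closed U -> measurable (U : set (borel T)).
Proof.
move=> cU; rewrite -[U]setCK; apply: measurableC; apply: borel_open.
exact: closed_openC.
Qed.

Lemma measurable_entry m n i j :
  measurable_fun setT (fun M : borel 'M[R]_(m, n) => M i j).
Proof.
apply: (measurability _ (measurable_realfun.RGenOpens.measurableE R)).
move=> _ [_ [a [b ->] <-]]; rewrite setTI; apply: borel_open.
have oab : open `]a, b[%classic by apply: interval_open.
by move/continuousP : (@coord_continuous R m n i j) => /(_ _ oab).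
Qed.

(** The Borel sets are generated by uncountably many open sets; a countable union of rational
    sup-norm balls leaves only finitely many conditions on entries per ball. *)
Lemma measurable_fun_mx d (T : measurableType d) m n
    (f : T -> borel 'M[R]_(m, n)) :
  (forall i j, measurable_fun setT (fun t => f t i j)) -> measurable_fun setT f.
Proof.
move=> mf; refine (@measurability _ _ T (borel 'M[R]_(m, n)) _ _ (@open 'M[R]_(m, n)) _ _) => //.
move=> _ [U oU <-]; rewrite setTI (open_bigcup_rball oU) preimage_bigcup.
apply: bigcup_countType_measurable => c _.
have -> : f @^-1` rball c = \bigcap_i \bigcap_j
    [set t | `|ratr (c.1 i j) - f t i j| < c.2.+1%:R^-1].
  by apply/seteqP; split => [t ft i _ j _|t ft i j]; [exact: ft|exact: (ft i _ j)].
apply: fin_bigcap_measurable; first exact: finite_finset.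
move=> i _; apply: fin_bigcap_measurable; first exact: finite_finset.
move=> j _; rewrite -[X in measurable X]setTI.
have -> : [set t | `|ratr (c.1 i j) - f t i j| < c.2.+1%:R^-1] =
   (fun t => f t i j) @^-1` ball (ratr (c.1 i j) : R) (c.2.+1%:R^-1) by [].
apply: mf => //; exact: measurable_ball.
Qed.

Lemma measurable_fun_mxE d (T : measurableType d) m n
    (f : T -> borel 'M[R]_(m, n)) i j :
  measurable_fun setT f -> measurable_fun setT (fun t => f t i j).
Proof. by move=> mf; apply: (measurableT_comp (measurable_entry i j)). Qed.

Lemma measurable_fun_mulmx d (T : measurableType d) m n p
    (f : T -> borel 'M[R]_(m, n)) (g : T -> borel 'M[R]_(n, p)) :
  measurable_fun setT f -> measurable_fun setT g ->
  measurable_fun setT (fun t => f t *m g t : borel 'M[R]_(m, p)).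
Proof.
move=> mf mg; apply: measurable_fun_mx => i j.
under eq_fun do rewrite mxE.
apply: measurable_sum => k.
by apply: measurable_funM; exact: measurable_fun_mxE.
Qed.

Lemma cvg_mx (T : Type) (F : set_system T) {FF : Filter F} m n
    (f : T -> 'M[R]_(m, n)) (M : 'M[R]_(m, n)) :
  (forall i j, f t i j @[t --> F] --> M i j) -> f @ F --> M.
Proof.
move=> fM A [P MP PA].
have : \forall t \near F, forall ij : 'I_m * 'I_n, P ij.1 ij.2 (f t ij.1 ij.2).
  by apply: filter_forall => -[i j]; exact/fM/MP.
by apply: filterS => t Pt; apply: PA => i j; exact: (Pt (i, j)).
Qed.

Lemma cvg_mulmx (T : Type) (F : set_system T) {FF : Filter F} m n p
    (f : T -> 'M[R]_(m, n)) (g : T -> 'M[R]_(n, p))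
    (A : 'M[R]_(m, n)) (B : 'M[R]_(n, p)) :
  f @ F --> A -> g @ F --> B -> f t *m g t @[t --> F] --> A *m B.
Proof.
move=> fA gB; apply: cvg_mx => i j; rewrite mxE.
under eq_fun do rewrite mxE.
apply: cvg_big => [|k _]; first exact: add_continuous.
apply: cvgM.
  exact: (cvg_comp _ _ fA (@coord_continuous R _ _ i k A)).
exact: (cvg_comp _ _ gB (@coord_continuous R _ _ k j B)).
Qed.

(** A tube argument: if [a *m M] is nonzero for each [a] in [K], it stays nonzero for [(a', N)] near
    [(a, M)], and compactness of [K] yields one neighbourhood of [M] that works for all of [K]. *)
Lemma kernel_meets_compact_closed m n (K : set 'rV[R]_m) : compact K ->
  closed [set M : 'M[R]_(m, n) | exists2 a, K a & a *m M = 0].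
Proof.
move=> cK; rewrite -[X in closed X]setCK; apply: open_closedC.
rewrite openE => M /= nM.
have : \forall N \near M, K `<=` [set a | a *m N != 0].
  move/compact_near_coveringP : cK.
  move=> /(_ _ (nbhs M) (fun N a => a *m N != 0) _); apply=> a Ka.
  have aM0 : a *m M != 0 by apply/eqP => aM; apply: nM; exists a.
  have : (fun z : 'rV[R]_m * 'M[R]_(m, n) => z.1 *m z.2) @ (a, M) --> a *m M.
    by apply: cvg_mulmx; [exact: cvg_fst|exact: cvg_snd].
  move/(_ [set b | b != 0]); apply.
  apply: open_nbhs_nbhs; split => //.
  rewrite (_ : [set b | _] = ~` [set 0]).
    apply/closed_openC/accessible_closed_set1/hausdorff_accessible.
    exact: norm_hausdorff.
  by apply/seteqP; split => b /= /eqP.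
apply: filterS => N KN [a Ka aN].
by have := KN _ Ka; rewrite /= aN eqxx.
Qed.

End BorelMatrices.

(** * Rotation invariance of the planar Gaussian measure *)

Section ReflectionInvariance.
Context {R : realType}.
Local Notation mu := (@lebesgue_measure R).
Local Open Scope ereal_scope.

Lemma measurable_affine (a b : R) :
  measurable_fun [set: measurableTypeR R]
    (fun x => (a * x + b)%R : measurableTypeR R).
Proof. by apply: measurable_funD => //; exact: measurable_funM. Qed.

(** The pushforward scaled by [|a|] has the right value on half-open intervals, and these determine
    Lebesgue measure. *)
Lemma lebesgue_measure_affine (a b : R) (A : set R) : (a != 0)%R ->
  measurable A ->
  mu ((fun x => (a * x + b)%R) @^-1` A) = `|a|^-1%:E * mu A.
Proof.
move=> a0 mA.
have ia : (0 < `|a|)%R by rewrite normr_gt0.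
pose f : measurableTypeR R -> measurableTypeR R := fun x => (a * x + b)%R.
pose k : {nonneg R} := NngNum (normr_ge0 a).
suff -> : mu A = mscale k (pushforward mu f) A; first exact: measurable_affine.
  by move=> mf; rewrite /mscale/= muleA -EFinM mulVf ?mul1e// gt_eqF.
move=> mf; apply: lebesgue_measure_unique => //.
move=> _ [[x y]] _ <-; rewrite /= /mscale /= /pushforward.
have fE z : (a * ((z - b) / a) + b = z)%R by rewrite mulrC divfK// subrK.
have [a_gt0|a_lt0|a_eq0] := ltgtP 0%R a; last by rewrite -a_eq0 eqxx in a0.
- have -> : f @^-1` `]x, y]%classic = `]((x - b) / a)%R, ((y - b) / a)%R]%classic.
    apply/seteqP; split => z /=; rewrite !in_itv/= ltr_pdivrMr// ler_pdivlMr//;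
    by rewrite ltrBlDr lerBrDr mulrC.
  rewrite !lebesgue_measure_itv/= !lte_fin ltr_pM2r ?invr_gt0// ltrD2r.
  case: ifPn => _; last by rewrite mule0.
  rewrite -!EFinD -EFinM gtr0_norm//; congr _%:E.
  by field; rewrite gt_eqF.
(* A negative slope exchanges the open and the closed end; the length is unaffected. *)
- have -> : f @^-1` `]x, y]%classic = `[((y - b) / a)%R, ((x - b) / a)%R[%classic.
    apply/seteqP; split => z /=; rewrite !in_itv/= ltr_ndivlMr// ler_ndivrMr//;
    by rewrite ltrBlDr lerBrDr mulrC andbC.
  rewrite !lebesgue_measure_itv/= !lte_fin ltr_nM2r ?invr_lt0// ltrD2r.
  case: ifPn => _; last by rewrite mule0.
  rewrite -!EFinD -EFinM ltr0_norm//; congr _%:E.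
  by field; rewrite lt_eqF.
Qed.

Lemma ge0_integral_affine (a b : R) (F : R -> \bar R) : (a != 0)%R ->
  measurable_fun setT F -> (forall x, 0 <= F x) ->
  \int[mu]_x F (a * x + b)%R = `|a|^-1%:E * \int[mu]_x F x.
Proof.
move=> a0 mF F0.
pose f : measurableTypeR R -> measurableTypeR R := fun x => (a * x + b)%R.
have k0 : (0 <= `|a|^-1)%R by rewrite invr_ge0.
transitivity (\int[pushforward mu f]_x F x).
  rewrite ge0_integral_pushforward//; first exact: measurable_affine.
transitivity (\int[mscale (NngNum k0) mu]_x F x).
  apply: eq_measure_integral; first exact: measurable_affine.
  by move=> mf A mA _; rewrite /= /mscale /= -(lebesgue_measure_affine b a0 mA).
by rewrite ge0_integral_mscale.
Qed.

(* Substitution [u = c x + s y] for fixed [y], then [v = (s u - y) / c] for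
   fixed [u]; the Jacobians [1 / |c|] and [|c|] cancel. *)
Lemma ge0_integral_reflect (c s : R) (F : R * R -> \bar R) :
  (c ^+ 2 + s ^+ 2 = 1)%R -> measurable_fun setT F -> (forall z, 0 <= F z) ->
  \int[mu]_x \int[mu]_y F (c * x + s * y, s * x - c * y)%R =
  \int[mu]_x \int[mu]_y F (x, y).
Proof.
move=> cs1 mF F0.
have mG : measurable_fun [set: measurableTypeR R * measurableTypeR R]
   (fun z => F (c * z.1 + s * z.2, s * z.1 - c * z.2)%R).
  apply: (measurableT_comp mF); apply: measurable_fun_pair.
    by apply: measurable_funD; exact: measurable_funM.
  by apply: measurable_funB; exact: measurable_funM.
have mF1 x : measurable_fun setT (fun y => F (x, y)).
  by apply: (measurableT_comp mF); exact: pair1_measurable.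
(* The substitution divides by [c]. For [c = 0] the map is [(x, y) |-> (s y, s x)] with [|s| = 1], a
   swap with signs, settled by Tonelli. *)
have [c0|c0] := eqVneq c 0%R.
  have s0 : (s != 0)%R.
    by apply: contra_eqN cs1 => /eqP ->; rewrite c0 expr0n/= addr0 eq_sym oner_eq0.
  have s1 : (`|s|^-1 = 1)%R.
    move: cs1; rewrite c0 expr0n/= add0r => /eqP; rewrite sqrf_eq1.
    by move=> /orP[] /eqP ->; rewrite ?normrN normr1 invr1.
  transitivity (\int[mu]_x \int[mu]_v F (v, s * x)%R).
    apply: eq_integral => x _.
    rewrite -[RHS]mul1e -[X in X%:E * _]s1 -(@ge0_integral_affine s 0)//.
      by apply: eq_integral => y _; rewrite c0 !mul0r subr0 add0r addr0.
    by apply: (measurableT_comp mF); exact: pair2_measurable.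
  apply: (etrans (@fubini_tonelli _ _ _ _ R mu mu (fun z => F (z.2, s * z.1)%R) _ _)) => //=.
    apply: (measurableT_comp mF); apply: measurable_fun_pair => //.
    exact: measurable_funM.
  apply: eq_integral => v _.
  rewrite -[RHS]mul1e -[X in X%:E * _]s1 -(@ge0_integral_affine s 0)//.
  by apply: eq_integral => y _; rewrite addr0.
apply: (etrans (@fubini_tonelli _ _ _ _ R mu mu
  (fun z => F (c * z.1 + s * z.2, s * z.1 - c * z.2)%R) _ _)) => //=.
have mH : measurable_fun [set: measurableTypeR R * measurableTypeR R]
    (fun z => F (z.1, (s * z.1 - z.2) / c)%R).
  apply: (measurableT_comp mF); apply: measurable_fun_pair => //.
  by apply: measurable_funM => //; apply: measurable_funB => //; exact: measurable_funM.
transitivity (\int[mu]_y (`|c|^-1%:E * \int[mu]_u F (u, (s * u - y) / c)%R)).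
  apply: eq_integral => y _.
  rewrite -(@ge0_integral_affine c (s * y) (fun u => F (u, (s * u - y) / c)%R))//.
    apply: eq_integral => x _; congr (F (_, _)).
    apply: (mulIf c0); rewrite divfK//.
    transitivity (s * (c * x + s * y) - (c ^+ 2 + s ^+ 2) * y)%R; first by ring.
    by rewrite cs1 mul1r.
  apply: (measurableT_comp mF); apply: measurable_fun_pair => //.
  by apply: measurable_funM => //; apply: measurable_funB => //; exact: measurable_funM.
rewrite ge0_integralZl//; last 2 first.
- exact: (@measurable_fun_fubini_tonelli_G _ _ _ _ R mu _ mH (fun=> F0 _)).
- by move=> y _; exact: integral_ge0.
transitivity (`|c|^-1%:E * \int[mu]_u \int[mu]_y F (u, (s * u - y) / c)%R).
  congr (_ * _); apply/esym.
  exact: (@fubini_tonelli _ _ _ _ R mu mu (fun z => F (z.1, (s * z.1 - z.2) / c)%R)).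
rewrite -ge0_integralZl//; last 2 first.
- exact: (@measurable_fun_fubini_tonelli_F _ _ _ _ R mu _ mH (fun=> F0 _)).
- by move=> y _; exact: integral_ge0.
apply: eq_integral => u _.
have c1 : (- c^-1 != 0)%R by rewrite oppr_eq0 invr_eq0.
transitivity (`|c|^-1%:E * \int[mu]_y F (u, - c^-1 * y + s * u / c)%R).
  congr (_ * _); apply: eq_integral => y _; congr (F (_, _)).
  by rewrite mulrBl addrC mulNr [(y / c)%R]mulrC.
rewrite (@ge0_integral_affine _ _ (fun v => F (u, v)))//.
by rewrite normrN normrV ?unitfE// invrK muleA -EFinM mulVf ?mul1e// normr_eq0.
Qed.

End ReflectionInvariance.

Section GaussianPlane.
Context {R : realType}.
Local Notation mu := (@lebesgue_measure R).
Local Notation N := (@normal_prob R 0 1).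
Local Notation phi := (@normal_pdf R 0 1).
Local Open Scope ereal_scope.

(** The Radon-Nikodym derivative of [N] and [phi] have the same integral over every measurable set,
    hence agree almost everywhere. *)
Lemma integral_normal_prob (f : R -> \bar R) :
  N.-integrable setT f ->
  \int[N]_x f x = \int[mu]_x (f x * (phi x)%:E).
Proof.
move=> intf; have mf := measurable_int _ intf.
have dom := @normal_prob_dominates R 0%R 1%R.
rewrite -(Radon_Nikodym_change_of_variables dom)//=.
apply: ae_eq_integral => //.
- apply: emeasurable_funM => //=; apply/measurableT_comp => //=.
- have mphi : measurable_fun setT (fun x : R => (phi x)%:E).
    by apply/measurable_EFinP; exact: measurable_normal_pdf.
  exact: (emeasurable_funM mf mphi).
- apply: ae_eqe_mul2l => /=.
  rewrite Radon_NikodymE//=.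
  case: cid => /= h [h1 h2 h3].
  apply: integral_ae_eq => //=.
  by apply/measurableT_comp =>//; exact: measurable_normal_pdf.
  by move=> E _ mE; rewrite -h3.
Qed.

(** The joint density depends only on the Euclidean norm, and [(c x + s y)^2 + (s x - c y)^2 = (c^2
    + s^2) (x^2 + y^2)]. *)
Lemma normal_pdf_reflect (c s x y : R) : (c ^+ 2 + s ^+ 2 = 1)%R ->
  (phi (c * x + s * y) * phi (s * x - c * y) = phi x * phi y)%R.
Proof.
move=> cs1; rewrite !normal_pdfE ?oner_eq0// /normal_fun.
rewrite mulrACA [RHS]mulrACA -!expRD; congr (_ * expR _)%R.
rewrite !subr0 -!mulrDl -!opprD; congr (- _ / _)%R.
transitivity ((c ^+ 2 + s ^+ 2) * (x ^+ 2 + y ^+ 2))%R; first by ring.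
by rewrite cs1 mul1r.
Qed.

Lemma normal_prob2E (A : set (R * R)) : measurable A ->
  (N \x N) A = \int[mu]_x \int[mu]_y ((\1_A (x, y))%:E * (phi x * phi y)%:E).
Proof.
move=> mA; rewrite /product_measure1.
have mphi : measurable_fun setT phi by exact: measurable_normal_pdf.
rewrite integral_normal_prob.
  apply: eq_integral => x _ /=.
  rewrite muleC /normal_prob integral_mkcond -ge0_integralZl//=; last 3 first.
  - by apply/(measurable_restrictT _ _).1; [exact: measurable_xsection|
      exact/measurable_funTS/measurable_EFinP].
  - by move=> y _; rewrite patchE; case: ifP => // _; rewrite lee_fin normal_pdf_ge0.
  - by rewrite lee_fin normal_pdf_ge0.
  apply: eq_integral => y _; rewrite patchE indicE mem_xsection.
  by case: ifP => _; rewrite ?mul1e ?mul0e ?mule0// EFinM.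
apply/integrableP; split; first exact: measurable_fun_xsection.
apply: (@le_lt_trans _ _ (\int[N]_x 1)).
  apply: ge0_le_integral => //=.
  - by apply: measurableT_comp => //; exact: measurable_fun_xsection.
  - by move=> x _; rewrite gee0_abs// probability_le1//; exact: measurable_xsection.
by rewrite integral_cst//= mul1e -ge0_fin_numE// fin_num_measure.
Qed.

Lemma normal_prob2_reflect (c s : R) (A : set (R * R)) :
  (c ^+ 2 + s ^+ 2 = 1)%R -> measurable A ->
  (N \x N) ((fun z => (c * z.1 + s * z.2, s * z.1 - c * z.2)%R) @^-1` A) =
  (N \x N) A.
Proof.
move=> cs1 mA.
have mphi : measurable_fun setT phi by exact: measurable_normal_pdf.
have mf : measurable_fun [set: R * R]
    (fun z => (c * z.1 + s * z.2, s * z.1 - c * z.2)%R).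
  apply: measurable_fun_pair.
    by apply: measurable_funD; exact: measurable_funM.
  by apply: measurable_funB; exact: measurable_funM.
have mB : measurable ((fun z => (c * z.1 + s * z.2, s * z.1 - c * z.2)%R) @^-1` A).
  by rewrite -[X in measurable X]setTI; exact: mf.
rewrite (normal_prob2E mA) (normal_prob2E mB).
pose F (z : R * R) := (\1_A z)%:E * (phi z.1 * phi z.2)%:E.
have F0 z : 0 <= F z by rewrite /F -EFinM lee_fin !mulr_ge0 ?normal_pdf_ge0.
have mF : measurable_fun setT F.
  rewrite /F; under eq_fun do rewrite -EFinM.
  apply/measurable_EFinP; apply: measurable_funM; first exact: measurable_indic.
  by apply: measurable_funM; exact: measurableT_comp.
refine (etrans _ (ge0_integral_reflect cs1 mF F0)).
apply: eq_integral => x _; apply: eq_integral => y _.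
by rewrite /F/= normal_pdf_reflect// !indicE.
Qed.

End GaussianPlane.

(** * Gaussian matrices *)

Section ImageProbability.
Context {R : realType} {d d' : measure_display} {T : measurableType d}
  {T' : measurableType d'}.

Definition image_prob (P : probability T R) (f : T -> T')
    (mf : measurable_fun setT f) : probability T' R :=
  distribution P (HB.pack_for {mfun T >-> T'} f (isMeasurableFun.Build _ _ _ _ f mf)).

Lemma image_probE (P : probability T R) f (mf : measurable_fun setT f) A :
  image_prob P mf A = P (f @^-1` A).
Proof. by []. Qed.

Lemma measurable_preimage (f : T -> T') A :
  measurable_fun setT f -> measurable A -> measurable (f @^-1` A).
Proof. by move=> mf mA; rewrite -[X in measurable X]setTI; exact: mf. Qed.

End ImageProbability.

Section GaussianMatrices.
Context {R : realType}.
Local Notation N := (@normal_prob R 0 1).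
Local Notation bM m n := (borel 'M[R]_(m, n)).

Definition box m n (B : 'I_m -> 'I_n -> set R) : set (bM m n) :=
  [set M | forall i j, B i j (M i j)].

(** The law of a matrix with independent standard normal entries, prescribed on boxes only;
    [eq_box_measure] shows that this determines it on Borel sets. *)
Definition gaussian_boxes m n (mu : set (bM m n) -> \bar R) :=
  forall B : 'I_m -> 'I_n -> set R, (forall i j, measurable (B i j)) ->
  mu (box B) = (\prod_(p : 'I_m * 'I_n) N (B p.1 p.2))%E.

Lemma measurable_box m n (B : 'I_m -> 'I_n -> set R) :
  (forall i j, measurable (B i j)) -> measurable (box B).
Proof.
move=> mB.
have -> : box B = \bigcap_i \bigcap_j ((fun M : bM m n => M i j) @^-1` B i j).
  by apply/seteqP; split => [M BM i _ j _|M BM i j]; [exact: BM|exact: (BM i _ j)].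
apply: fin_bigcap_measurable; first exact: finite_finset.
move=> i _; apply: fin_bigcap_measurable; first exact: finite_finset.
by move=> j _; apply: measurable_preimage => //; exact: measurable_entry.
Qed.

(** Boxes are stable under intersection, so what remains is that they generate the Borel sets. *)
Lemma eq_box_measure m n (mu nu : probability (bM m n) R) :
  (forall B, (forall i j, measurable (B i j)) -> mu (box B) = nu (box B)) ->
  forall A, measurable A -> mu A = nu A.
Proof.
move=> munu.
pose G : set (set (bM m n)) := [set A | exists2 B : 'I_m -> 'I_n -> set R,
  forall i j, measurable (B i j) & A = box B].
have GT : G setT.
  exists (fun _ _ => setT) => //.
  by apply/seteqP; split => M.
have mG : @measurable _ (bM m n) = <<s G >>.
  apply/seteqP; split => [A mA|A GA].
    (* Entries are measurable for the sigma-algebra generated by boxes, hence so is the identity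
       into the Borel space, and every Borel set belongs to that sigma-algebra. *)
    have mid : measurable_fun [set: g_sigma_algebraType G]
        (fun M : g_sigma_algebraType G => (M : 'M[R]_(m, n)) : bM m n).
      apply: measurable_fun_mx => i j _ B mB; rewrite setTI.
      apply: sub_sigma_algebra.
      exists (fun i' j' => if (i', j') == (i, j) then B else setT).
        by move=> i' j'; case: ifP => // _; exact: measurableT.
      apply/seteqP; split => [M /= BM i' j'|M /= BM].
        by case: ifP => // /eqP[-> ->].
      by have := BM i j; rewrite eqxx.
    by have := mid measurableT A mA; rewrite setTI.
  apply: (smallest_sub (@sigma_algebra_measurable _ (bM m n)) _ GA).
  by move=> _ [B mB ->]; exact: measurable_box.
apply: (measure_unique G (fun=> setT)) => //.
- move=> _ _ [B mB ->] [C mC ->].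
  exists (fun i j => B i j `&` C i j) => [i j|]; first exact: measurableI.
  apply/seteqP; split => [M [BM CM] i j|M BCM]; first by split.
  by split => i j; have [] := BCM i j.
- by apply/seteqP; split => // M _; exists 0%N.
- by move=> _ [B mB ->]; exact: munu.
- by move=> _; rewrite -ge0_fin_numE// fin_num_measure.
Qed.

(** Each step of the induction adds one factor [R] to the sample space, which is why the display and
    the type are existential. *)
Lemma iid_gaussian_exists K : exists (d : measure_display) (T : measurableType d)
  (P : probability T R) (Z : 'I_K -> T -> R),
  (forall i, measurable_fun setT (Z i)) /\
  forall B : 'I_K -> set R, (forall i, measurable (B i)) ->
  P [set t | forall i, B i (Z i t)] = (\prod_(i < K) N (B i))%E.
Proof.
elim: K => [|K [d [T [P [Z [mZ PZ]]]]]].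
  exists _, unit, (\d_tt)%R, (fun _ _ => 0); split => [[]//|B _].
  rewrite big_ord0 (_ : [set t | _] = setT) ?probability_setT//.
  by apply/seteqP; split => // t _ [].
exists _, (T * measurableTypeR R)%type, (P \x N)%E.
exists (fun i t => if unlift ord_max i is Some j then Z j t.1 else t.2).
split => [i|B mB].
  by case: unliftP => [j|] _; [exact: measurableT_comp|exact: measurable_snd].
rewrite big_ord_recr/=.
rewrite -(PZ (fun i => B (widen_ord (leqnSn K) i)))//.
have -> : [set t : T * R | forall i, B i (match unlift ord_max i with
    | Some j => Z j t.1 | None => t.2 end)] =
    [set t | forall i, B (widen_ord (leqnSn K) i) (Z i t)] `*` B ord_max.
  have wE (i : 'I_K) : widen_ord (leqnSn K) i = lift ord_max i.
    by apply: ord_inj; rewrite lift_max.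
  apply/seteqP; split => [[t x] /= BZ|[t x] /= [BZ Bx] i].
    split => [i|]; last by have := BZ ord_max; rewrite unlift_none.
    by rewrite wE; have := BZ (lift ord_max i); rewrite liftK.
  by case: unliftP => [j ->|->//]; rewrite -wE.
apply: product_measure1E => //; last exact: mB.
have -> : [set t | forall i, B (widen_ord (leqnSn K) i) (Z i t)] =
   \bigcap_i (Z i @^-1` B (widen_ord (leqnSn K) i)).
  by apply/seteqP; split => [t BZ i _|t BZ i]; [exact: BZ|exact: (BZ i)].
apply: fin_bigcap_measurable; first exact: finite_finset.
by move=> i _; exact: measurable_preimage.
Qed.

Lemma gaussian_boxes_exists m n : exists mu : probability (bM m n) R,
  gaussian_boxes mu.
Proof.
have [d [T [P [Z [mZ PZ]]]]] := iid_gaussian_exists #|{: 'I_m * 'I_n}|.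
pose f t : bM m n := \matrix_(i, j) Z (enum_rank (i, j)) t.
have mf : measurable_fun setT f.
  apply: measurable_fun_mx => i j; rewrite /f.
  under eq_fun do rewrite mxE.
  exact: mZ.
exists (image_prob P mf) => B mB; rewrite image_probE.
pose C (i : 'I_#|{: 'I_m * 'I_n}|) : set R := B (enum_val i).1 (enum_val i).2.
have -> : f @^-1` box B = [set t | forall i, C i (Z i t)].
  apply/seteqP; split => [t Bt k|t Ct i j].
    by have := Bt (enum_val k).1 (enum_val k).2; rewrite mxE -surjective_pairing enum_valK.
  by rewrite mxE; have := Ct (enum_rank (i, j)); rewrite /C enum_rankK.
rewrite PZ; last by move=> i; exact: mB.
rewrite (reindex (@enum_rank _)) /=; last first.
  by apply: onW_bij; exact: enum_rank_bij.
by apply: eq_bigr => p _; rewrite /C enum_rankK.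
Qed.

Definition gmx m n : probability (bM m n) R :=
  [get mu : probability (bM m n) R | gaussian_boxes mu].

Lemma gmx_box m n : gaussian_boxes (gmx m n).
Proof.
rewrite /gmx; apply: (@getPex _ (fun mu : probability (bM m n) R => gaussian_boxes mu)).
exact: gaussian_boxes_exists.
Qed.

Lemma gmx_image d (T : measurableType d) (P : probability T R) m n
    (f : T -> bM m n) : measurable_fun setT f ->
  (forall B : 'I_m -> 'I_n -> set R, (forall i j, measurable (B i j)) ->
    P (f @^-1` box B) = (\prod_(p : 'I_m * 'I_n) N (B p.1 p.2))%E) ->
  forall A, measurable A -> P (f @^-1` A) = gmx m n A.
Proof.
move=> mf fB A mA; rewrite -(image_probE P mf); apply: eq_box_measure => // B mB.
by rewrite gmx_box// image_probE fB.
Qed.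

Lemma gmx_trmx m n A : measurable A ->
  gmx m n ((fun M => M^T : bM n m) @^-1` A) = gmx n m A.
Proof.
apply: gmx_image => [|B mB].
  apply: measurable_fun_mx => i j; under eq_fun do rewrite mxE.
  exact: measurable_entry.
have -> : (fun M : bM m n => M^T : bM n m) @^-1` box B = box (fun i j => B j i).
  by apply/seteqP; split => M BM i j; have := BM j i; rewrite mxE.
rewrite gmx_box// [RHS](reindex (fun p : 'I_m * 'I_n => (p.2, p.1)))//=.
by exists (fun p => (p.2, p.1)) => -[].
Qed.

(** A box for the submatrix is a box for the whole matrix whose unselected sides are [setT], of
    probability 1; injectivity keeps a side from being prescribed twice. *)
Lemma gmx_mxsub m n m' n' (f : 'I_m' -> 'I_m) (g : 'I_n' -> 'I_n) A :
  injective f -> injective g -> measurable A ->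
  gmx m n ((fun M => mxsub f g M : bM m' n') @^-1` A) = gmx m' n' A.
Proof.
move=> fI gI; apply: gmx_image => [|B mB].
  apply: measurable_fun_mx => i j; under eq_fun do rewrite mxE.
  exact: measurable_entry.
pose h (p : 'I_m' * 'I_n') := (f p.1, g p.2).
have hI : injective h by move=> [i j] [i' j'] [/fI -> /gI ->].
pose C i j := if [pick p | h p == (i, j)] is Some p then B p.1 p.2 else setT.
have Ch p : C (h p).1 (h p).2 = B p.1 p.2.
  rewrite /C; case: pickP => [q /eqP|/(_ p)]; last by rewrite -surjective_pairing eqxx.
  by rewrite -surjective_pairing => /hI ->.
have -> : (fun M : bM m n => mxsub f g M : bM m' n') @^-1` box B = box C.
  apply/seteqP; split => [M BM i j|M CM i j].
    by rewrite /C; case: pickP => // p /eqP[<- <-]; have := BM p.1 p.2; rewrite mxE.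
  by have := CM (h (i, j)).1 (h (i, j)).2; rewrite Ch mxE.
rewrite gmx_box; last by move=> i j; rewrite /C; case: pickP => // *; exact: measurableT.
rewrite (bigID (fun q => q \in codom h))/= [X in (_ * X)%E]big1 ?mule1; last first.
  move=> [i j] /= nij; rewrite /C; case: pickP => [p /eqP hp|_]; last exact: probability_setT.
  by move: nij; rewrite -hp codom_f.
rewrite -big_uniq/=; last exact/injectiveP.
by rewrite big_image/=; apply: eq_bigr => p _; exact: (congr1 _ (Ch p)).
Qed.

Definition normal_prob2 : probability (measurableTypeR R * measurableTypeR R)%type R :=
  (N \x N)%E.

Local Notation N2 := normal_prob2.

(** For [p = q] the first coordinate of [z] wins and the second is discarded; this case serves for
    sign changes and for resampling a single entry. *)
Definition upd2 m n (p q : 'I_m * 'I_n) (M : 'M[R]_(m, n)) (z : R * R) :=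
  \matrix_(i, j) if (i, j) == p then z.1 else if (i, j) == q then z.2 else M i j.

Lemma measurable_upd2 m n (p q : 'I_m * 'I_n) :
  measurable_fun [set: bM m n * (R * R)] (fun t => upd2 p q t.1 t.2 : bM m n).
Proof.
apply: measurable_fun_mx => i j; rewrite /upd2; under eq_fun do rewrite mxE.
case: ((i, j) == p); first exact: measurableT_comp.
case: ((i, j) == q); first exact: measurableT_comp.
by apply: measurable_fun_mxE; exact: measurable_fst.
Qed.

(** Stands in for conditioning on the other entries: two entries are resampled independently, so
    that Fubini can isolate them. *)
Lemma gmx_upd2 m n (p q : 'I_m * 'I_n) A : measurable A ->
  (gmx m n \x N2)%E ((fun t => upd2 p q t.1 t.2 : bM m n) @^-1` A) = gmx m n A.
Proof.
apply: gmx_image => [|B mB]; first exact: measurable_upd2.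
pose C i j := if ((i, j) == p) || ((i, j) == q) then setT else B i j.
(* For [q = p] the second fresh coordinate is discarded, hence unconstrained. *)
pose Bq := if q == p then setT else B q.1 q.2.
have -> : (fun t => upd2 p q t.1 t.2 : bM m n) @^-1` box B =
    box C `*` (B p.1 p.2 `*` Bq).
  apply/seteqP; split => [[M [x y]] /= BM|[M [x y]] /= [CM [/= Bx By]] i j].
    split; last split => /=.
    - move=> i j; rewrite /C; have := BM i j; rewrite mxE.
      by case: eqP => //= _; case: eqP.
    - by have := BM p.1 p.2; rewrite mxE -surjective_pairing eqxx.
    - rewrite /Bq; case: ifPn => // qp.
      by have := BM q.1 q.2; rewrite mxE -surjective_pairing (negbTE qp) eqxx.
  rewrite mxE; case: eqP => [pE|np]; first by rewrite -[i]/(i, j).1 -[j]/(i, j).2 pE.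
  case: eqP => [qE|nq].
    by move: By; rewrite /Bq -qE; case: eqP => // /np.
  by have := CM i j; rewrite /C; move/eqP/negbTE : np => ->; move/eqP/negbTE : nq => ->.
have mC i j : measurable (C i j).
  by rewrite /C; case: ifP => // _; exact: measurableT.
have mBq : measurable Bq by rewrite /Bq; case: ifP => // _; exact: measurableT.
have mBB : measurable (B p.1 p.2 `*` Bq) by exact: measurableX.
have H := @product_measure1E _ _ _ _ R (gmx m n) N2 _ _ (measurable_box mC) mBB.
transitivity (\prod_(r : 'I_m * 'I_n) N (C r.1 r.2) * (N (B p.1 p.2) * N Bq))%E.
  apply: (etrans H); congr (_ * _)%E; first exact: gmx_box.
  by apply: product_measure1E; [exact: mB|exact: mBq].
rewrite muleC -muleA.
rewrite (bigD1 p)//= [RHS](bigD1 p)//=; congr (_ * _)%E.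
have -> : C p.1 p.2 = setT by rewrite /C -surjective_pairing eqxx.
rewrite probability_setT mul1e.
have [qp|qp] := eqVneq q p.
  rewrite /Bq qp eqxx probability_setT mul1e; apply: eq_bigr => -[i j] ijp.
  by rewrite /C /= qp (negbTE ijp).
rewrite (bigD1 q)//= [RHS](bigD1 q)//= /Bq (negbTE qp); congr (_ * _)%E.
have -> : C q.1 q.2 = setT by rewrite /C -surjective_pairing eqxx orbT.
rewrite probability_setT mul1e; apply: eq_bigr => -[i j] /andP[ijp ijq].
by rewrite /C /= (negbTE ijp) (negbTE ijq).
Qed.

(** With the remaining entries frozen, [f] acts on the resampled pair as [g], so a planar invariance
    lifts to matrices section by section. *)
Lemma gmx_upd2_invariant m n (p q : 'I_m * 'I_n) (f : 'M[R]_(m, n) -> 'M[R]_(m, n))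
    (g : R * R -> R * R) :
  measurable_fun setT (f : bM m n -> bM m n) ->
  (forall B, measurable B -> N2 (g @^-1` B) = N2 B) ->
  (forall M z, f (upd2 p q M z) = upd2 p q M (g z)) ->
  forall A : set (bM m n), measurable A -> gmx m n (f @^-1` A) = gmx m n A.
Proof.
move=> mf mg fg A mA.
have mfA : measurable ((f : bM m n -> bM m n) @^-1` A) by exact: measurable_preimage.
rewrite -(gmx_upd2 p q mfA) -(gmx_upd2 p q mA).
apply: eq_integral => M _ /=.
pose S := (fun z => upd2 p q M z : bM m n) @^-1` A.
have mS : measurable S.
  apply: measurable_preimage => //.
  exact: (measurableT_comp (measurable_upd2 p q) (pair1_measurable M)).
have -> : xsection ((fun t => upd2 p q t.1 t.2) @^-1` (f @^-1` A)) M = g @^-1` S.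
  by apply/seteqP; split => z; rewrite /xsection/= inE /= fg.
have -> : xsection ((fun t => upd2 p q t.1 t.2) @^-1` A) M = S.
  by apply/seteqP; split => z; rewrite /xsection/= inE.
exact: mg.
Qed.

End GaussianMatrices.

(** * Orthogonal invariance of Gaussian matrices *)

Section OrthogonalInvariance.
Context {R : realType}.
Local Notation N := (@normal_prob R 0 1).
Local Notation bM m n := (borel 'M[R]_(m, n)).

(** When [c^2 + s^2 = 1], the planar matrix with rows [(c, s)] and [(s, -c)] is symmetric and
    orthogonal: a reflection, chosen over a rotation because it is its own inverse. *)
Definition reflect_entries m n (p q : 'I_m * 'I_n) (c s : R) (M : 'M[R]_(m, n)) :=
  upd2 p q M (c * M p.1 p.2 + s * M q.1 q.2, s * M p.1 p.2 - c * M q.1 q.2).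

Lemma measurable_reflect_entries m n (p q : 'I_m * 'I_n) (c s : R) :
  measurable_fun setT (reflect_entries p q c s : bM m n -> bM m n).
Proof.
have mpair : measurable_fun setT (fun M : bM m n =>
    (M, (c * M p.1 p.2 + s * M q.1 q.2, s * M p.1 p.2 - c * M q.1 q.2))).
  apply: measurable_fun_pair => //; apply: measurable_fun_pair.
    by apply: measurable_funD; apply: measurable_funM => //; exact: measurable_entry.
  by apply: measurable_funB; apply: measurable_funM => //; exact: measurable_entry.
exact: (measurableT_comp (measurable_upd2 p q) mpair).
Qed.

(** The alternative [s == 0] admits [p = q]; then [c^2 = 1] and the map at most changes the sign of
    one entry, as the treatment of diagonal entries [-1] requires. *)
Lemma gmx_reflect_entries m n (p q : 'I_m * 'I_n) (c s : R) A :
  c ^+ 2 + s ^+ 2 = 1 -> (q != p) || (s == 0) -> measurable A ->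
  gmx m n ((reflect_entries p q c s : bM m n -> bM m n) @^-1` A) = gmx m n A.
Proof.
move=> cs1 pq; apply: (gmx_upd2_invariant (p := p) (q := q)
  (g := fun z => (c * z.1 + s * z.2, s * z.1 - c * z.2))).
- exact: measurable_reflect_entries.
- by move=> B mB; exact: normal_prob2_reflect.
- move=> M [x y]; case: (eqVneq q p) pq => [-> /= /eqP -> | qp _].
    apply/matrixP => i j; rewrite !mxE -!surjective_pairing eqxx.
    by case: ((i, j) == p); rewrite //= !mul0r !addr0.
  apply/matrixP => i j; rewrite !mxE -!surjective_pairing !eqxx (negbTE qp).
  by case: ((i, j) == p) => //=; case: ((i, j) == q).
Qed.

Definition reflect_cols m n (a b : 'I_n) (c s : R) (M : 'M[R]_(m, n)) :=
  \matrix_(i, j) if j == a then c * M i a + s * M i b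
                 else if j == b then s * M i a - c * M i b else M i j.

Lemma reflect_colsE m n (a b : 'I_n) (c s : R) (M : 'M[R]_(m, n)) :
  reflect_cols a b c s M = M *m reflect_cols a b c s 1%:M.
Proof.
apply/matrixP => i j; rewrite !mxE.
have E l : \sum_k M i k * (1%:M : 'M[R]_n) k l = M i l.
  by have /matrixP/(_ i l) := mulmx1 M; rewrite mxE.
under eq_bigr do rewrite mxE.
have [ja|ja] := eqVneq j a.
  under eq_bigr do rewrite mulrDr !(mulrCA (M _ _)).
  by rewrite big_split/= -!mulr_sumr !E.
have [jb|jb] := eqVneq j b.
  under eq_bigr do rewrite mulrBr !(mulrCA (M _ _)).
  by rewrite big_split/= sumrN -!mulr_sumr !E.
by rewrite E.
Qed.

Lemma reflect_colsK m n (a b : 'I_n) (c s : R) : c ^+ 2 + s ^+ 2 = 1 ->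
  (b != a) || (s == 0) -> involutive (@reflect_cols m n a b c s).
Proof.
move=> cs1 ab M; apply/matrixP => i j; rewrite !mxE !eqxx.
case: (eqVneq b a) ab => [-> /= /eqP s0|ba _].
  case: eqP => // ->; rewrite s0 !mul0r !addr0 mulrA.
  by move: cs1; rewrite s0 expr0n/= addr0 expr2 => ->; rewrite mul1r.
case: eqP => [->|_].
  transitivity ((c ^+ 2 + s ^+ 2) * M i a); [by ring|by rewrite cs1 mul1r].
case: eqP => // ->.
transitivity ((c ^+ 2 + s ^+ 2) * M i b); [by ring|by rewrite cs1 mul1r].
Qed.

Lemma reflect_cols1_tr n (a b : 'I_n) (c s : R) :
  (b != a) || (s == 0) ->
  (reflect_cols a b c s 1%:M)^T = reflect_cols a b c s 1%:M.
Proof.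
move=> ab; apply/matrixP => i j; rewrite !mxE.
have neqs (k l : 'I_n) : k != l -> ((k == l) = false) * ((l == k) = false).
  by move=> kl; rewrite [l == k]eq_sym (negbTE kl).
case: (altP (b =P a)) ab => [-> /= /eqP -> | /neqs ba _].
  case: (altP (i =P a)) => [ia|/neqs ia]; case: (altP (j =P a)) => [ja|/neqs ja];
  by rewrite ?ia ?ja ?eqxx ?ia ?ja ?mul0r ?mulr0 ?addr0 // eq_sym.
case: (altP (i =P a)) => [ia|/neqs ia]; case: (altP (i =P b)) => [ib|/neqs ib];
case: (altP (j =P a)) => [ja|/neqs ja]; case: (altP (j =P b)) => [jb|/neqs jb];
rewrite ?ia ?ja ?ib ?jb ?eqxx ?ia ?ja ?ib ?jb ?ba ?mul0r ?mulr0 ?addr0 ?add0r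
  ?subr0 ?sub0r ?mulr1 ?oppr0 //.
- by move: ba; rewrite -ib ia eqxx => -[].
- by move: ba; rewrite -ib ia eqxx => -[].
- by move: ba; rewrite -jb ja eqxx => -[].
- by move: ba; rewrite -jb ja eqxx => -[].
- by rewrite eq_sym.
Qed.

Lemma measurable_mulmxr m n p (Q : 'M[R]_(n, p)) :
  measurable_fun setT (fun M : bM m n => M *m Q : bM m p).
Proof. by apply: measurable_fun_mulmx => //; exact: measurable_cst. Qed.

Lemma measurable_mulmxl m n p (Q : 'M[R]_(m, n)) :
  measurable_fun setT (fun M : bM n p => Q *m M : bM m p).
Proof. by apply: measurable_fun_mulmx => //; exact: measurable_cst. Qed.

Lemma gmx_reflect_cols m n (a b : 'I_n) (c s : R) A :
  c ^+ 2 + s ^+ 2 = 1 -> (b != a) || (s == 0) -> measurable A ->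
  gmx m n ((fun M : bM m n => M *m reflect_cols a b c s 1%:M : bM m n) @^-1` A)
  = gmx m n A.
Proof.
move=> cs1 ab mA.
(* [F k] reflects only the first [k] rows; passing to [k.+1] reflects two entries of a single
   row. *)
pose F k (M : bM m n) : bM m n :=
  \matrix_(i, j) if (i < k)%N then reflect_cols a b c s M i j else M i j.
have FS k : (k <= m)%N -> measurable_fun setT (F k) /\
    forall A, measurable A -> gmx m n (F k @^-1` A) = gmx m n A.
  elim: k => [_|k IHk km].
    have F0 : F 0%N = id by apply/funext => M; apply/matrixP => i j; rewrite mxE.
    by rewrite F0; split => //; exact: measurable_id.
  have [mFk gFk] := IHk (ltnW km).
  pose p := (Ordinal km, a); pose q := (Ordinal km, b).
  pose f := reflect_entries p q c s : bM m n -> bM m n.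
  have mf : measurable_fun setT f by exact: measurable_reflect_entries.
  have FSE : F k.+1 = f \o F k.
    apply/funext => M; apply/matrixP => i j; rewrite !mxE /= ltnn -!pair_eqE /=.
    have [->|ik] := eqVneq i (Ordinal km).
      by rewrite ltnn ltnSn /=.
    by rewrite /= ltnS leq_eqVlt -[i == k :> nat]/(i == Ordinal km) (negbTE ik).
  rewrite FSE; split; first exact: measurableT_comp.
  move=> B mB; rewrite comp_preimage gFk; last exact: measurable_preimage.
  apply: gmx_reflect_entries => //.
  by rewrite -pair_eqE /= eqxx.
have [_ /(_ _ mA) <-] := FS m (leqnn m); congr (gmx m n (_ @^-1` A)).
by apply/funext => M; rewrite -reflect_colsE; apply/matrixP => i j;
  rewrite [RHS]mxE ltn_ord.
Qed.

(* [reflect_cols] with suitable coefficients clears the entries to the right of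
   the diagonal one at a time, row by row, until the identity is reached. *)
Lemma orthogonal_reflect_ind n (P : 'M[R]_n -> Prop) :
  P 1%:M ->
  (forall (Q : 'M[R]_n) a b c s, c ^+ 2 + s ^+ 2 = 1 -> (b != a) || (s == 0) ->
     P (Q *m reflect_cols a b c s 1%:M) -> P Q) ->
  forall Q : 'M[R]_n, Q *m Q^T = 1%:M -> P Q.
Proof.
move=> P1 PH.
pose fixes r (Q : 'M[R]_n) := forall i j : 'I_n, (i < r)%N -> Q i j = (i == j)%:R.
suff H d r (Q : 'M[R]_n) : (r + d = n)%N -> fixes r Q -> Q *m Q^T = 1%:M -> P Q.
  by move=> Q Qo; apply: (H n 0%N).
elim: d r Q => [|d IHd] r Q rdn Qr Qo.
  rewrite addn0 in rdn; suff -> : Q = 1%:M by [].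
  by apply/matrixP => i j; rewrite mxE Qr// rdn.
have rn : (r < n)%N by rewrite -rdn -addSnnS leq_addr.
pose a := Ordinal rn.
have Qrow (Q' : 'M[R]_n) : Q' *m Q'^T = 1%:M -> forall i,
    \sum_j Q' a j * Q' i j = (a == i)%:R.
  move=> /matrixP Q'o i; have := Q'o a i; rewrite !mxE => <-.
  by apply: eq_bigr => j _; rewrite mxE.
have reflo (Q' : 'M[R]_n) b c s : c ^+ 2 + s ^+ 2 = 1 -> (b != a) || (s == 0) ->
    Q' *m Q'^T = 1%:M ->
    (Q' *m reflect_cols a b c s 1%:M) *m (Q' *m reflect_cols a b c s 1%:M)^T = 1%:M.
  move=> cs1 ab Q'o; rewrite trmx_mul reflect_cols1_tr// mulmxA -(mulmxA Q').
  by rewrite -reflect_colsE reflect_colsK// mulmx1.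
(* Inner induction along row [a]: the entries strictly between the diagonal and column [t] already
   vanish, and [e] columns remain. *)
suff H e t (Q' : 'M[R]_n) : (t + e = n)%N -> (r < t)%N -> fixes r Q' ->
    (forall j : 'I_n, (r < j)%N -> (j < t)%N -> Q' a j = 0) ->
    Q' *m Q'^T = 1%:M -> P Q'.
  apply: (H d r.+1) => //; first by rewrite addSnnS.
  by move=> j rj; rewrite ltnS leqNgt rj.
elim: e t Q' => [|e IHe] t Q' ten rt Q'r Q'0 Q'o.
  (* Left of the diagonal no reflection is called for: orthogonality to the earlier rows, already
     those of the identity, gives 0. *)
  have Q'a j : j != a -> Q' a j = 0.
    move=> ja; have [jr|jr] := ltnP j r.
      have := Qrow _ Q'o j; rewrite (bigD1 j)//= big1 => [|l lj].
        rewrite addr0 (Q'r j)// eqxx mulr1 => ->.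
        by rewrite eq_sym (negbTE ja).
      by rewrite (Q'r j)// eq_sym (negbTE lj) mulr0.
    apply: Q'0; last by move: (ltn_ord j); rewrite -[X in (_ < X)%N]ten addn0.
    by rewrite ltn_neqAle jr andbT eq_sym.
  have Q'aa : Q' a a ^+ 2 = 1.
    have := Qrow _ Q'o a; rewrite (bigD1 a)//= big1 => [|l la].
      by rewrite addr0 eqxx.
    by rewrite Q'a// mul0r.
  have fix_next (Q'' : 'M[R]_n) : fixes r Q'' -> Q'' a a = 1 ->
      (forall j, j != a -> Q'' a j = 0) -> fixes r.+1 Q''.
    move=> Q''r aa Q''a i j; rewrite ltnS leq_eqVlt => /orP[ir|/Q''r//].
    have -> : i = a by apply/eqP.
    have [<-//|ja] := eqVneq a j; apply: Q''a; by rewrite eq_sym.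
  move/eqP : Q'aa; rewrite sqrf_eq1 => /orP[/eqP aa|/eqP aa].
    by apply: (IHd r.+1) => //; [rewrite addSnnS|exact: fix_next].
  (* A diagonal entry [-1] is flipped by the degenerate reflection with [a = b], [c = -1],
     [s = 0]. *)
  have cs : (-1 : R) ^+ 2 + 0 ^+ 2 = 1 by rewrite sqrrN expr1n expr0n/= addr0.
  apply: (PH Q' a a (-1) 0 cs); first by rewrite !eqxx.
  have E i j : (Q' *m reflect_cols a a (-1) 0 1%:M) i j =
      if j == a then - Q' i a else Q' i j.
    by rewrite -reflect_colsE mxE; case: eqP; rewrite // mul0r addr0 mulN1r.
  apply: (IHd r.+1); [by rewrite addSnnS| |by apply: reflo => //; rewrite !eqxx].
  apply: fix_next.
  - move=> i j ir; rewrite E; case: eqP => [->|_]; last exact: Q'r.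
    rewrite Q'r// (_ : i == a = false) ?oppr0//.
    by apply/eqP => ia; move: ir; rewrite ia ltnn.
  - by rewrite E eqxx aa opprK.
  - by move=> j ja; rewrite E (negbTE ja) Q'a.
have tn : (t < n)%N by rewrite -ten -addSnnS leq_addr.
pose b := Ordinal tn.
have ba : b != a by apply/eqP => /(congr1 val)/= tr; move: rt; rewrite tr ltnn.
have [y0|y0] := eqVneq (Q' a b) 0.
  apply: (IHe t.+1) => //; [by rewrite addSnnS|exact: ltnW|].
  move=> j rj; rewrite ltnS leq_eqVlt => /orP[/eqP jt|]; last exact: Q'0.
  by rewrite -y0; congr (Q' a _); apply: val_inj.
(* With [c] and [s] the entries of row [a] at [a] and [b] divided by [rho], the new entry at [b] is
   [s * Q' a a - c * Q' a b = 0]. *)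
pose rho := Num.sqrt (Q' a a ^+ 2 + Q' a b ^+ 2).
have rho2 : rho ^+ 2 = Q' a a ^+ 2 + Q' a b ^+ 2.
  by rewrite sqr_sqrtr// addr_ge0// sqr_ge0.
have rho0 : rho != 0.
  by rewrite -sqrf_eq0 rho2 gt_eqF// ltr_wpDl ?sqr_ge0// exprn_even_gt0.
have cs : (Q' a a / rho) ^+ 2 + (Q' a b / rho) ^+ 2 = 1.
  by rewrite !expr_div_n -mulrDl -rho2 divff// expf_neq0.
have ab : (b != a) || (Q' a b / rho == 0) by rewrite ba.
apply: (PH Q' a b _ _ cs ab).
apply: (IHe t.+1); [by rewrite addSnnS|exact: ltnW| | |exact: reflo].
- move=> i j ir; rewrite -reflect_colsE mxE !(Q'r i)//.
  have ia : (i == a) = false by apply/eqP => ia; move: ir; rewrite ia ltnn.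
  have ib : (i == b) = false.
    by apply/eqP => ib; move: ir; rewrite ib/= ltnNge ltnW.
  case: eqP => [->|_]; first by rewrite ia ib !mulr0 addr0.
  by case: eqP => [->|//]; rewrite ia ib !mulr0 subr0.
- move=> j rj; rewrite ltnS leq_eqVlt -reflect_colsE mxE => jt.
  have -> : j == a = false by apply/eqP => ja; move: rj; rewrite ja ltnn.
  case/orP: jt => [/eqP jt|jt].
    have -> : j == b by apply/eqP/val_inj.
    by field.
  have -> : j == b = false by apply/eqP => jb; move: jt; rewrite jb ltnn.
  exact: Q'0.
Qed.

Lemma gmx_mulmxr m n (Q : 'M[R]_n) A : Q *m Q^T = 1%:M -> measurable A ->
  gmx m n ((fun M : bM m n => M *m Q : bM m n) @^-1` A) = gmx m n A.
Proof.
move=> Qo; move: Q Qo A; apply: orthogonal_reflect_ind => [A mA|Q a b c s cs ab PQ A mA].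
  by congr (gmx m n _); apply/seteqP; split => M /=; rewrite mulmx1.
have mH := measurable_preimage (@measurable_mulmxr m n n (reflect_cols a b c s 1%:M)) mA.
rewrite -[RHS](gmx_reflect_cols cs ab mA) -(PQ _ mH).
congr (gmx m n _); apply/seteqP; split => M /=;
by rewrite -!mulmxA -reflect_colsE reflect_colsK// mulmx1.
Qed.

Lemma gmx_mulmxl m n (Q : 'M[R]_m) A : Q *m Q^T = 1%:M -> measurable A ->
  gmx m n ((fun M : bM m n => Q *m M : bM m n) @^-1` A) = gmx m n A.
Proof.
move=> Qo mA; have Qto : Q^T *m Q^T^T = 1%:M by rewrite trmxK; exact: mulmx1C.
have mT m' n' : measurable_fun setT (fun M : bM m' n' => M^T : bM n' m').
  apply: measurable_fun_mx => i j; under eq_fun do rewrite mxE.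
  exact: measurable_entry.
have mTA := measurable_preimage (@mT n m) mA.
rewrite -[RHS](gmx_trmx mA) -(gmx_mulmxr Qto mTA).
have mTQA := measurable_preimage (@measurable_mulmxr n m m Q^T) mTA.
rewrite -[LHS](gmx_trmx (measurable_preimage (@measurable_mulmxl m m n Q) mA)).
by congr (gmx n m _); apply/seteqP; split => M /=; rewrite trmx_mul trmxK.
Qed.

End OrthogonalInvariance.

(** * Singular square Gaussian matrices form a null set *)

Section GaussianDeterminant.
Context {R : realType}.
Local Notation bM m n := (borel 'M[R]_(m, n)).

Lemma measurable_det n : measurable_fun setT (fun M : bM n n => \det (M : 'M[R]_n)).
Proof.
rewrite /determinant; apply: measurable_sum => s.
apply: measurable_funM => //; apply: measurable_prod => i _.
exact: measurable_entry.
Qed.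

Lemma measurable_det_eq0 n : measurable [set M : bM n n | \det (M : 'M[R]_n) = 0].
Proof.
rewrite -[X in measurable X]setTI.
exact: (@measurable_det n measurableT [set 0] (measurable_set1 0)).
Qed.

Lemma normal_prob2_affine0 (a b : R) : a != 0 ->
  normal_prob2 [set z | z.1 * a + b = 0] = 0%E.
Proof.
move=> a0.
have -> : [set z | z.1 * a + b = 0] = [set - b / a] `*` [set: R].
  apply/seteqP; split => [[x y] /= |[x y] /= [-> _]]; last by rewrite divfK// addNr.
  by move=> /eqP; rewrite addr_eq0 => /eqP <-; rewrite mulfK.
apply: (etrans (product_measure1E _ _ _ _)) => //.
apply: (etrans _ (mul0e _)); congr (_ * _)%E.
exact: integral_set1.
Qed.

(** The determinant is affine in its top left entry, with slope the complementary minor. Resampling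
    that entry hits the single root with probability 0 unless the minor vanishes, a null event by
    induction. *)
Lemma gmx_det_eq0 n : gmx n n [set M : bM n n | \det (M : 'M[R]_n) = 0] = 0%E.
Proof.
elim: n => [|n IHn].
  rewrite (_ : [set _ | _] = set0) ?measure0//.
  by apply/seteqP; split => // M /=; rewrite det_mx00 => /eqP; rewrite oner_eq0.
pose p : 'I_n.+1 * 'I_n.+1 := (0, 0).
pose minor0 (M : bM n.+1 n.+1) : bM n n := mxsub (lift 0) (lift 0) (M : 'M[R]_n.+1).
have mminor : measurable_fun setT minor0.
  apply: measurable_fun_mx => i j; rewrite /minor0; under eq_fun do rewrite mxE.
  exact: measurable_entry.
have detE (M : 'M[R]_n.+1) z : \det (upd2 p p M z) =
    z.1 * \det (minor0 M) + \sum_(j < n) M 0 (lift 0 j) * cofactor M 0 (lift 0 j).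
  rewrite (expand_det_row _ 0) big_ord_recl.
  have cofE j : cofactor (upd2 p p M z) 0 j = cofactor M 0 j.
    congr (_ * \det _); apply/matrixP => i k; rewrite !mxE.
    by rewrite -pair_eqE.
  congr (_ + _).
    rewrite mxE eqxx cofE /cofactor expr0 mul1r; congr (_ * \det _).
    by apply/matrixP => i k; rewrite !mxE.
  by apply: eq_bigr => j _; rewrite cofE mxE.
have mD := @measurable_det_eq0 n.+1.
have mE : measurable (minor0 @^-1` [set M | \det (M : 'M[R]_n) = 0]).
  exact: measurable_preimage mminor (@measurable_det_eq0 n).
apply/eqP; rewrite eq_le measure_ge0 andbT.
rewrite -(gmx_upd2 p p mD).
have <- : (\int[gmx n.+1 n.+1]_M
    (\1_(minor0 @^-1` [set M | \det (M : 'M[R]_n) = 0]) M)%:E = 0)%E.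
  rewrite integral_indic// setIT.
  by rewrite -[RHS]IHn; apply: gmx_mxsub (@measurable_det_eq0 n); exact: lift_inj.
have mU := measurable_preimage (@measurable_upd2 R _ _ p p) mD.
apply: ge0_le_integral => //.
- exact: (@measurable_fun_xsection _ _ _ _ _ (@normal_prob2 R) _ mU).
- exact/measurable_EFinP/measurable_indic.
move=> M _; have [M0|M0] := eqVneq (\det (minor0 M : 'M[R]_n)) 0.
  rewrite indicE mem_set//.
  by apply: probability_le1; exact: measurable_xsection.
apply: (@le_trans _ _ 0%E); last by rewrite lee_fin.
rewrite [X in (X <= _)%E](_ : _ = 0%E)//.
rewrite /comp.
have -> : xsection ((fun t => upd2 p p t.1 t.2) @^-1` [set M : bM n.+1 n.+1 | \det (M : 'M[R]_n.+1) = 0]) M =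
  [set z | z.1 * \det (minor0 M) + \sum_(j < n) M 0 (lift 0 j) * cofactor M 0 (lift 0 j) = 0].
  by apply/seteqP; split => z; rewrite /xsection/= inE/= detE.
exact: normal_prob2_affine0.
Qed.

End GaussianDeterminant.

(** * Gram-Schmidt *)

Section GramSchmidt.
Context {R : realType} {n : nat}.
Implicit Types (g O : 'M[R]_n) (u v w : 'rV[R]_n) (q : nat -> 'rV[R]_n).

Definition dotr v w : R := (v *m w^T) 0 0.

Lemma dotr_mulmx O v w : O *m O^T = 1%:M -> dotr (v *m O) (w *m O) = dotr v w.
Proof. by move=> Oo; rewrite /dotr trmx_mul mulmxA -(mulmxA v) Oo mulmx1. Qed.

Lemma dotrE v w : dotr v w = \sum_j v 0 j * w 0 j.
Proof. by rewrite /dotr mxE; apply: eq_bigr => j _; rewrite mxE. Qed.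

Lemma dotrC v w : dotr v w = dotr w v.
Proof. by rewrite !dotrE; apply: eq_bigr => j _; rewrite mulrC. Qed.

Lemma dotrvv_eq0 v : dotr v v = 0 -> v = 0.
Proof.
rewrite dotrE => /psumr_eq0P v0; apply/rowP => j; rewrite mxE.
have /eqP : v 0 j * v 0 j = 0 by apply: v0 => // k _; rewrite -expr2 sqr_ge0.
by rewrite mulf_eq0 orbb => /eqP.
Qed.

Lemma dotrvv_ge0 v : 0 <= dotr v v.
Proof. by rewrite dotrE sumr_ge0// => j _; rewrite -expr2 sqr_ge0. Qed.

Definition gs_residue k q v := v - \sum_(i < k) dotr v (q i) *: q i.

(** The scalar is the inverse Euclidean norm of [w], written as a real power because [powR] is
    measurable on the whole line. *)
Definition gs_step k q v :=
  let w := gs_residue k q v in (dotr w w `^ (- 2^-1)) *: w.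

Definition rownat g k : 'rV[R]_n := if insub k is Some i then row i g else 0.

Lemma rownat_ord g (i : 'I_n) : rownat g i = row i g.
Proof. by rewrite /rownat valK. Qed.

(** Indexing by [nat] permits plain recursion: stage [k] holds the first [k] rows, and 0 beyond
    them. *)
Fixpoint gs_rows g k : nat -> 'rV[R]_n :=
  if k is k'.+1 then
    fun i => if i == k' then gs_step k' (gs_rows g k') (rownat g k')
             else gs_rows g k' i
  else fun=> 0.

Definition gram_schmidt g : 'M[R]_n := \matrix_(i < n) gs_rows g n i.

(** All coefficients of Gram-Schmidt are functions of inner products, which [O] preserves. *)
Lemma gs_rows_equivariant g O k i : O *m O^T = 1%:M ->
  gs_rows (g *m O) k i = gs_rows g k i *m O.
Proof.
move=> Oo; elim: k i => [|k IHk] i /=; first by rewrite mul0mx.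
case: eqP => // _; rewrite /gs_step.
have -> : gs_residue k (gs_rows (g *m O) k) (rownat (g *m O) k) =
    gs_residue k (gs_rows g k) (rownat g k) *m O.
  have -> : rownat (g *m O) k = rownat g k *m O.
    by rewrite /rownat; case: insubP => [j _ _|_]; rewrite ?row_mul ?mul0mx.
  rewrite /gs_residue mulmxBl mulmx_suml; congr (_ - _); apply: eq_bigr => j _.
  by rewrite IHk dotr_mulmx// scalemxAl.
by rewrite dotr_mulmx// scalemxAl.
Qed.

Lemma gram_schmidt_equivariant g O : O *m O^T = 1%:M ->
  gram_schmidt (g *m O) = gram_schmidt g *m O.
Proof.
by move=> Oo; apply/row_matrixP => i; rewrite row_mul !rowK gs_rows_equivariant.
Qed.

Lemma dotrBl u v w : dotr (u - v) w = dotr u w - dotr v w.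
Proof. by rewrite /dotr mulmxBl mxE [in X in _ + X]mxE. Qed.

Lemma dotrZl a v w : dotr (a *: v) w = a * dotr v w.
Proof. by rewrite /dotr -scalemxAl mxE. Qed.

Lemma dotrZr a v w : dotr v (a *: w) = a * dotr v w.
Proof. by rewrite dotrC dotrZl dotrC. Qed.

Lemma dotr_suml (I : finType) (F : I -> 'rV[R]_n) w :
  dotr (\sum_i F i) w = \sum_i dotr (F i) w.
Proof. by rewrite /dotr mulmx_suml summxE. Qed.

(** Coefficient vectors keep full length and vanish from index [k] on, so spans for different [k]
    compare without casts. *)
Definition span_rows g k v :=
  exists2 c : 'rV[R]_n, (forall j : 'I_n, (k <= j)%N -> c 0 j = 0) & v = c *m g.

Lemma span_rowsS g k l v : (k <= l)%N -> span_rows g k v -> span_rows g l v.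
Proof. by move=> kl [c c0 ->]; exists c => // j lj; apply: c0; exact: leq_trans lj. Qed.

Lemma span_rowsD g k v w : span_rows g k v -> span_rows g k w -> span_rows g k (v + w).
Proof.
move=> [c c0 ->] [c' c'0 ->]; exists (c + c'); last by rewrite mulmxDl.
by move=> j kj; rewrite mxE c0// c'0// addr0.
Qed.

Lemma span_rowsZ g k a v : span_rows g k v -> span_rows g k (a *: v).
Proof.
move=> [c c0 ->]; exists (a *: c); last by rewrite scalemxAl.
by move=> j kj; rewrite mxE c0// mulr0.
Qed.

Lemma span_rows_sum g k (I : finType) (F : I -> 'rV[R]_n) :
  (forall i, span_rows g k (F i)) -> span_rows g k (\sum_i F i).
Proof.
move=> Fk; apply: big_ind => [| |i _]; [|exact: span_rowsD|exact: Fk].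
by exists 0 => [j _|]; rewrite ?mxE ?mul0mx.
Qed.

Lemma span_rows_ord g (i : 'I_n) : span_rows g i.+1 (row i g).
Proof.
exists (delta_mx 0 i); last by rewrite rowE.
by move=> j ij; rewrite mxE eqxx /=; case: eqP ij => // ->; rewrite ltnn.
Qed.

Lemma gs_rows_span g k i : (k <= n)%N -> (i < k)%N ->
  span_rows g i.+1 (gs_rows g k i).
Proof.
elim: k i => // k IHk i kn; rewrite ltnS leq_eqVlt => /orP[/eqP ->|ik] /=; last first.
  by rewrite ltn_eqF//; apply: IHk => //; exact: ltnW.
rewrite eqxx; apply: span_rowsZ.
rewrite /gs_residue -[rownat g k]/(rownat g (Ordinal kn)) rownat_ord.
apply: span_rowsD; first exact: (@span_rows_ord g (Ordinal kn)).
rewrite -sumrN; apply: span_rows_sum => j; rewrite -scaleNr; apply: span_rowsZ.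
by apply: span_rowsS (IHk j (ltnW kn) (ltn_ord j)); rewrite ltnS ltnW.
Qed.

(** Otherwise row [k] would be a combination of the earlier rows, and multiplying by the inverse of
    [g] would make the coefficient at [k] both 1 and 0. *)
Lemma gs_residue_neq0 g k : g \in unitmx -> (k < n)%N ->
  gs_residue k (gs_rows g k) (rownat g k) != 0.
Proof.
move=> gu kn.
have [c c0 cE] : span_rows g k
    (\sum_(i < k) dotr (rownat g k) (gs_rows g k i) *: gs_rows g k i).
  apply: span_rows_sum => i; apply: span_rowsZ.
  by apply: span_rowsS (gs_rows_span g (ltnW kn) (ltn_ord i)).
rewrite /gs_residue cE -[rownat g k]/(rownat g (Ordinal kn)) rownat_ord rowE -mulmxBl.
apply/eqP => /(congr1 (mulmx^~ (invmx g))); rewrite mulmxK// mul0mx.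
move=> /rowP/(_ (Ordinal kn)); rewrite !mxE !eqxx c0//= subr0 => /eqP.
by rewrite oner_eq0.
Qed.

Lemma gs_rows_orthonormal g k : g \in unitmx -> (k <= n)%N ->
  forall i j, (i < k)%N -> (j < k)%N ->
  dotr (gs_rows g k i) (gs_rows g k j) = (i == j)%:R.
Proof.
move=> gu; elim: k => // k IHk kn.
have orth j : (j < k)%N -> dotr (gs_rows g k.+1 k) (gs_rows g k j) = 0.
  move=> jk /=; rewrite eqxx /gs_step dotrZl; move: (_ `^ _) => a.
  rewrite /gs_residue dotrBl dotr_suml.
  rewrite (bigD1 (Ordinal jk))//= dotrZl IHk// ?eqxx ?mulr1; last exact: ltnW.
  rewrite big1 => [|i ij]; first by rewrite addr0 subrr mulr0.
  rewrite dotrZl IHk//; last exact: ltnW.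
  by rewrite (_ : (i == j :> nat) = false) ?mulr0//; apply/negbTE.
have lt i : (i < k)%N -> gs_rows g k.+1 i = gs_rows g k i by move=> ik /=; rewrite ltn_eqF.
move=> i j; rewrite !ltnS (leq_eqVlt i) (leq_eqVlt j) => /orP[/eqP ->|ik] /orP[/eqP ->|jk].
- rewrite eqxx /= eqxx /gs_step dotrZl dotrZr mulrA.
  set w := gs_residue _ _ _; have w0 : 0 < dotr w w.
    rewrite lt_neqAle dotrvv_ge0 andbT eq_sym; apply/eqP => /dotrvv_eq0/eqP.
    by apply/negP/gs_residue_neq0.
  rewrite -powRD; last by rewrite (gt_eqF w0) implybT.
  rewrite (_ : - 2^-1 + - 2^-1 = -1); last by field.
  by rewrite powR_inv1 ?mulVf ?(gt_eqF w0)// ltW.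
- by rewrite (lt j)// orth// gtn_eqF.
- by rewrite (lt i)// dotrC orth// ltn_eqF.
- by rewrite (lt i)// (lt j)// IHk// ltnW.
Qed.

Lemma gram_schmidt_orthogonal g : g \in unitmx ->
  gram_schmidt g *m (gram_schmidt g)^T = 1%:M.
Proof.
move=> gu; apply/matrixP => i j; rewrite !mxE.
have := gs_rows_orthonormal gu (leqnn n) (ltn_ord i) (ltn_ord j).
by rewrite dotrE val_eqE => <-; apply: eq_bigr => l _; rewrite !mxE.
Qed.

Lemma gram_schmidt_span g k : (k <= n)%N -> forall i : 'I_n, (i < k)%N ->
  span_rows g k (row i (gram_schmidt g)).
Proof.
move=> kn i ik; rewrite rowK; apply: span_rowsS (gs_rows_span g (leqnn n) (ltn_ord i)).
exact: ik.
Qed.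

Lemma measurable_dotr d (T : measurableType d) (f h : T -> borel 'rV[R]_n) :
  measurable_fun setT f -> measurable_fun setT h ->
  measurable_fun setT (fun t => dotr (f t) (h t)).
Proof.
move=> mf mh; under eq_fun do rewrite dotrE.
by apply: measurable_sum => j; apply: measurable_funM; exact: measurable_fun_mxE.
Qed.

Lemma measurable_gs_rows k i :
  measurable_fun setT (fun g : borel 'M[R]_n => gs_rows g k i : borel 'rV[R]_n).
Proof.
elim: k i => [|k IHk] i /=; first exact: measurable_cst.
case: (i == k); last exact: IHk.
have mrow : measurable_fun setT (fun g : borel 'M[R]_n => rownat g k : borel 'rV[R]_n).
  apply: measurable_fun_mx => i' j; rewrite /rownat.
  case: insub => [l|]; last exact: measurable_cst.
  by under eq_fun do rewrite mxE; exact: measurable_entry.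
have mres : measurable_fun setT (fun g : borel 'M[R]_n =>
    gs_residue k (gs_rows g k) (rownat g k) : borel 'rV[R]_n).
  apply: measurable_fun_mx => i' j; rewrite /gs_residue.
  under eq_fun do rewrite mxE [X in _ + X]mxE summxE.
  apply: measurable_funB; first exact: measurable_fun_mxE.
  apply: measurable_sum => l; under eq_fun do rewrite mxE.
  by apply: measurable_funM; [exact: measurable_dotr|exact: measurable_fun_mxE].
apply: measurable_fun_mx => i' j; rewrite /gs_step; under eq_fun do rewrite mxE.
apply: measurable_funM; last exact: measurable_fun_mxE.
by apply: (measurableT_comp (measurable_powR _)); exact: measurable_dotr.
Qed.

Lemma measurable_gram_schmidt :
  measurable_fun setT (fun g : borel 'M[R]_n => gram_schmidt g : borel 'M[R]_n).
Proof.
apply: measurable_fun_mx => i j; under eq_fun do rewrite mxE.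
by apply: measurable_fun_mxE; exact: measurable_gs_rows.
Qed.

End GramSchmidt.

(** * The sigma-algebra on subspaces *)

Section Subspaces.
Context {R : realType}.
Local Notation bM m n := (borel 'M[R]_(m, n)).

Lemma mulmxr_continuous m n p (Q : 'M[R]_(n, p)) :
  continuous (fun M : 'M[R]_(m, n) => M *m Q).
Proof.
by move=> M; apply: (@cvg_mulmx _ _ (nbhs M) _ _ _ _ id (fun=> Q) M Q);
  [exact: cvg_id|exact: cvg_cst].
Qed.

Lemma row_free_kerP m n (M : 'M[R]_(m, n)) :
  reflect (forall c : 'rV[R]_m, c *m M = 0 -> c = 0) (row_free M).
Proof.
apply: (iffP idP) => [fM c cM0|M0].
  by apply: (row_free_inj fM); rewrite cM0 mul0mx.
rewrite -kermx_eq0; apply/eqP/row_matrixP => i; rewrite row0; apply: M0.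
by rewrite -row_mul mulmx_ker row0.
Qed.

Lemma free_rows m n (M : 'M[R]_(m, n)) :
  row_free M = free [tuple row i M | i < m].
Proof.
apply/row_free_kerP/freeP => [fM c cM0 i|fM c cM0].
  have : \row_j c j = 0.
    apply: fM; rewrite mulmx_sum_row -[RHS]cM0; apply: eq_bigr => j _.
    by rewrite mxE -tnth_nth tnth_mktuple.
  by move=> /rowP/(_ i); rewrite !mxE.
apply/rowP => i; rewrite [RHS]mxE; apply: fM.
rewrite -[RHS]cM0 mulmx_sum_row; apply: eq_bigr => j _.
by rewrite -tnth_nth tnth_mktuple.
Qed.

Lemma row_free_dim m n (M : 'M[R]_(m, n)) (W : {vspace 'rV[R]_n}) :
  row_free M -> (forall i, row i M \in W) -> (m <= \dim W)%N.
Proof.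
rewrite free_rows => fM MW.
have : (<<[tuple row i M | i < m]>> <= W)%VS.
  by apply/span_subvP => _ /mapP[i _ ->].
by move/dimvS; rewrite (eqnP fM) size_tuple.
Qed.

Lemma row_free_basis n (W : {vspace 'rV[R]_n}) m : (m <= \dim W)%N ->
  exists2 M : 'M[R]_(m, n), row_free M & forall i, row i M \in W.
Proof.
move=> mW; exists (\matrix_(i < m) (vbasis W)`_i); last first.
  by move=> i; rewrite rowK vbasis_mem// mem_nth// size_tuple (leq_trans (ltn_ord i)).
have fX : free (take m (vbasis W)).
  by have := basis_free (vbasisP W); rewrite -{1}(cat_take_drop m (vbasis W)) cat_free => /and3P[].
have sz : size (take m (vbasis W)) == m by rewrite size_takel// size_tuple.
rewrite free_rows (_ : [tuple _ | i < m] = Tuple sz)//.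
apply: eq_from_tnth => i; rewrite tnth_mktuple rowK (tnth_nth 0) /= nth_take//.
Qed.

Definition sphere m : set 'rV[R]_m := [set a | `|a| = 1].

Lemma sphere_compact m : compact (@sphere m).
Proof.
apply: bounded_closed_compact.
  exists 1; split => // x x1 a /= ->; exact: ltW.
rewrite (_ : @sphere m = (fun a : 'rV[R]_m => `|a|) @^-1` [set 1]) //.
apply: closed_comp; last exact: closed_eq.
by move=> a _; exact: norm_continuous.
Qed.

Lemma normalize_sphere m (a : 'rV[R]_m) : a != 0 -> sphere (`|a|^-1 *: a).
Proof.
by move=> a0; rewrite /sphere/= normrZ normfV normr_id mulVf// normr_eq0.
Qed.

Lemma sphere_neq0 m (a : 'rV[R]_m) : sphere a -> a != 0.
Proof. by move=> a1; rewrite -normr_eq0 a1 oner_eq0. Qed.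

(** Dependence of the rows is witnessed on the compact unit sphere, hence is a closed condition. *)
Lemma row_free_open m n : open [set M : 'M[R]_(m, n) | row_free M].
Proof.
rewrite (_ : [set M | _] = ~` [set M | exists2 a, sphere a & a *m M = 0]).
  exact/closed_openC/kernel_meets_compact_closed/sphere_compact.
apply/seteqP; split => [M /row_free_kerP fM [a a1 aM]|M nM].
  by move: (sphere_neq0 a1); rewrite (fM _ aM) eqxx.
apply/row_free_kerP => c cM; apply/eqP; apply: contra_notT nM => c0.
exists (`|c|^-1 *: c); first exact: normalize_sphere.
by rewrite -scalemxAl cM scaler0.
Qed.

Section HitMeasurability.
Context {n : nat}.
Local Notation lin := (lin_subspace R n).
Implicit Types (U K : set 'rV[R]_n) (W : lin).

Definition hits U : set lin := [set W | exists2 x, U x & x \in (W : {vspace 'rV[R]_n})].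

Lemma measurable_hits_open U : open U -> measurable (hits U).
Proof. by move=> oU; apply: sub_sigma_algebra; exists U. Qed.

Lemma measurable_fun_lin d (T : measurableType d) (f : T -> lin) :
  (forall U, open U -> measurable (f @^-1` hits U)) -> measurable_fun setT f.
Proof.
move=> fU.
refine (@measurability _ _ T lin _ _ (@open_hits R n) _ _) => //.
by move=> _ [_ [U oU <-] <-]; rewrite setTI; exact: fU.
Qed.

Lemma vspace_closed (W : {vspace 'rV[R]_n}) : closed [set` W].
Proof.
have -> : [set` W] = (fun x : 'rV[R]_n => x *m (1%:M - lin1_mx (projv W))) @^-1` [set 0].
  apply/seteqP; split => x /=; rewrite mulmxBr mulmx1 mul_rV_lin1 /=.
    by move=> /projv_id ->; rewrite subrr.
  by move=> /eqP; rewrite subr_eq0 => /eqP ->; exact: memv_proj.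
apply: closed_comp; first by move=> x _; exact: mulmxr_continuous.
apply: accessible_closed_set1; apply: hausdorff_accessible; exact: norm_hausdorff.
Qed.

(** The generators concern open sets only. As [W] is closed and [K] compact, [W] meets [K] iff it
    meets every neighbourhood of [K] of radius [1 / (k + 1)]. *)
Lemma measurable_hits_compact K : compact K -> measurable (hits K).
Proof.
move=> cK.
pose V k := \bigcup_(x in K) ball x (k.+1%:R^-1 : R) : set 'rV[R]_n.
have -> : hits K = \bigcap_k hits (V k).
  apply/seteqP; split => [W [x Kx Wx] k _|W VW].
    by exists x => //; exists x => //; apply: ballxx; rewrite invr_gt0.
  apply: contrapT => nKW.
  have : \forall k \near \oo, K `<=`
      [set x | forall y, ball x (k.+1%:R^-1 : R) y -> y \notin (W : {vspace 'rV[R]_n})].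
    move/compact_near_coveringP : cK => /(_ _ \oo (fun k x =>
      forall y, ball x (k.+1%:R^-1 : R) y -> y \notin (W : {vspace 'rV[R]_n})) _).
    apply => x Kx.
    have Wx : (~` [set` (W : {vspace 'rV[R]_n})]) x by move=> Wx; apply: nKW; exists x.
    have /nbhs_ballP[e /= e0 eW] := open_nbhs_nbhs (conj (closed_openC (@vspace_closed W)) Wx).
    exists (ball x (e / 2), [set k | k.+1%:R^-1 < e / 2]) => /=.
      split; first by apply: nbhsx_ballx; rewrite divr_gt0.
      exact: (near_infty_natSinv_lt (PosNum (divr_gt0 e0 (ltr0Sn R 1)))).
    move=> [x' k] [/= xx' ke] y x'y; apply/negP; apply: eW.
    rewrite [e]splitr; apply: ball_triangle xx' _.
    exact: le_ball (ltW ke) _ x'y.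
  move=> [k _ /(_ k (leqnn k)) KW].
  have [y [x Kx xy] Wy] := VW k I.
  by have := KW x Kx y xy; rewrite Wy.
apply: bigcapT_measurable => k; apply: measurable_hits_open.
by apply: bigcup_open => x _; exact: ball_open.
Qed.

(** Independence being open, [m] independent vectors of [W] fit into rational balls from which every
    choice is independent; this leaves countably many hitting events. *)
Lemma measurable_dim_ge m : measurable [set W : lin | (m <= \dim (W : {vspace 'rV[R]_n}))%N].
Proof.
pose rowc (C : 'M[rat]_(m, n) * nat) i := (row i C.1, C.2).
have -> : [set W : lin | (m <= \dim (W : {vspace 'rV[R]_n}))%N] =
  \bigcup_(C in [set C | rcball C `<=` [set M : 'M[R]_(m, n) | row_free M]])
    \bigcap_i hits (rball (rowc C i)).
  apply/seteqP; split => [W /row_free_basis[M fM MW]|W [C CM CW]].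
    have [C CM CU] := rball_basis (@row_free_open m n) fM.
    exists C => // i _; exists (row i M) => // k j; rewrite !mxE; exact: CM.
  have /fin_all_exists2[x xC xW] i : exists2 x, rball (rowc C i) x & x \in (W : {vspace _}).
    exact: CW.
  apply: (@row_free_dim _ _ (\matrix_i x i)) => [|i]; last by rewrite rowK.
  apply: CM; apply: rball_sub => i j; rewrite mxE.
  by have := xC i 0 j; rewrite /= mxE.
apply: bigcup_countType_measurable => C _; apply: fin_bigcap_measurable.
  exact: finite_finset.
by move=> i _; apply: measurable_hits_open; exact: rball_open.
Qed.

Lemma measurable_dim_eq m : measurable [set W : lin | \dim (W : {vspace 'rV[R]_n}) = m].
Proof.
rewrite (_ : [set W | _] = [set W : lin | (m <= \dim (W : {vspace 'rV[R]_n}))%N] `\`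
   [set W : lin | (m.+1 <= \dim (W : {vspace 'rV[R]_n}))%N]).
  by apply: measurableD; exact: measurable_dim_ge.
apply/seteqP; split => [W /= ->|W /= [mW /negP]]; first by rewrite ltnn.
by rewrite -leqNgt => Wm; apply/eqP; rewrite eqn_leq mW Wm.
Qed.

Lemma memv_rotate (Q : 'M[R]_n) W y :
  (y \in (rotate Q W : {vspace 'rV[R]_n})) <->
  exists2 x, x \in (W : {vspace 'rV[R]_n}) & y = x *m Q.
Proof.
split => [/memv_imgP[x Wx ->]|[x Wx ->]]; first by exists x; rewrite // lfunE.
by apply/memv_imgP; exists x; rewrite // lfunE.
Qed.

Lemma rotate_mul (Q1 Q2 : 'M[R]_n) W :
  rotate Q2 (rotate Q1 W) = rotate (Q1 *m Q2) W.
Proof.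
apply/vspaceP => y; apply/idP/idP => /memv_rotate[x Wx ->].
  move/memv_rotate : Wx => [x' Wx' ->]; apply/memv_rotate; exists x' => //.
  by rewrite mulmxA.
apply/memv_rotate; exists (x *m Q1); last by rewrite mulmxA.
by apply/memv_rotate; exists x.
Qed.

(** Fubini over rotation and subspace needs joint measurability. By continuity of the product, the
    event is a countable union of rectangles, one for each pair of rational balls whose products lie
    in [U]. *)
Lemma measurable_rotate d (T : measurableType d) (F : T -> bM n n) :
  measurable_fun setT F ->
  measurable_fun setT (fun z : T * lin => rotate (F z.1) z.2).
Proof.
move=> mF; apply: measurable_fun_lin => U oU.
pose D : set ('rV[rat]_n * nat * ('M[rat]_n * nat)) := [set c | forall (x : 'rV[R]_n) (Q : 'M[R]_n),
  rball c.1 x -> rball c.2 Q -> U (x *m Q)].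
have -> : (fun z : T * lin => rotate (F z.1) z.2) @^-1` hits U =
  \bigcup_(c in D) ((F @^-1` rball c.2) `*` hits (rball c.1)).
  apply/seteqP; split => [[t W] /= [y Uy /memv_rotate[x Wx yE]]|[t W] [[c C] cCU [/= tC [x cx Wx]]]].
    have : (fun z : 'rV[R]_n * 'M[R]_n => z.1 *m z.2) @ (x, F t : 'M[R]_n) --> x *m F t.
      by apply: cvg_mulmx; [exact: cvg_fst|exact: cvg_snd].
    rewrite -yE => /(_ U (open_nbhs_nbhs (conj oU Uy))) [[A B] /= [/nbhs_interior xA /nbhs_interior tB] ABU].
    have [c cx cA] := rball_basis (@open_interior _ A) (nbhs_singleton xA).
    have [C Ct CB] := rball_basis (@open_interior _ B) (nbhs_singleton tB).
    exists (c, C); last by split => //; exists x.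
    move=> x' Q cx' CQ; apply: (ABU (x', Q)); split.
      by apply: interior_subset; apply: cA; exact: rball_sub.
    by apply: interior_subset; apply: CB; exact: rball_sub.
  exists (x *m F t); first exact: cCU.
  by apply/memv_rotate; exists x.
apply: bigcup_countType_measurable => c _; apply: measurableX.
  by apply: measurable_preimage => //; apply: borel_open; exact: rball_open.
by apply: measurable_hits_open; exact: rball_open.
Qed.

Definition row_kernel m (A : 'M[R]_(n, m)) : lin := lker (linfun (mulmxr A)).

Lemma mem_row_kernel m (A : 'M[R]_(n, m)) x :
  (x \in (row_kernel A : {vspace 'rV[R]_n})) = (x *m A == 0).
Proof. by rewrite memv_ker lfunE. Qed.

(** Exhausting [U] by compact rational balls makes the hitting event a countable union of closed
    sets of matrices. *)
Lemma measurable_row_kernel m :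
  measurable_fun setT (fun A : bM n m => row_kernel A).
Proof.
apply: measurable_fun_lin => U oU.
have -> : (fun A : bM n m => row_kernel A) @^-1` hits U =
  \bigcup_(c in [set c | rcball c `<=` U]) [set A : 'M[R]_(n, m) | exists2 x, rcball c x & x *m A = 0].
  apply/seteqP; split => [A [x]|A [c cU [x cx xA]]].
    move=> /(rball_basis oU)[c cx cU]; rewrite mem_row_kernel => /eqP xA.
    by exists c => //; exists x => //; exact: rball_sub.
  by exists x; [exact: cU|rewrite mem_row_kernel xA].
apply: bigcup_countType_measurable => c _; apply: borel_closed.
exact/kernel_meets_compact_closed/rcball_compact.
Qed.

End HitMeasurability.
End Subspaces.

(** * Orthonormal bases adapted to a subspace *)

Section AdaptedBasis.
Context {R : realType} {n : nat}.
Implicit Types (W : {vspace 'rV[R]_n}).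

Lemma memv_mulmx m (M : 'M[R]_(m, n)) W (c : 'rV[R]_m) :
  (forall i, c 0 i != 0 -> row i M \in W) -> c *m M \in W.
Proof.
move=> MW; rewrite mulmx_sum_row; apply: memv_suml => i _.
by have [->|ci] := eqVneq (c 0 i) 0; [rewrite scale0r mem0v|rewrite memvZ ?MW].
Qed.

Lemma row_free_span m (M : 'M[R]_(m, n)) W x : m = \dim W ->
  row_free M -> (forall i, row i M \in W) -> x \in W -> exists b, x = b *m M.
Proof.
move=> mW; rewrite free_rows => fM MW.
set X := [tuple row i M | i < m].
have -> : W = <<X>>%VS.
  apply/eqP; rewrite eq_sym eqEdim (eqnP fM) size_tuple -mW leqnn andbT.
  by apply/span_subvP => _ /mapP[i _ ->].
move=> /coord_span xE; exists (\row_i coord X i x).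
rewrite mulmx_sum_row [LHS]xE; apply: eq_bigr => i _.
by rewrite mxE -tnth_nth tnth_mktuple.
Qed.

(** A basis of [W] is completed to an invertible matrix, and Gram-Schmidt keeps its initial rows
    inside the span of those they come from. *)
Lemma orthonormal_adapted W :
  exists2 O : 'M[R]_n, O *m O^T = 1%:M &
    forall x, x \in W <-> span_rows O (\dim W) x.
Proof.
have [M fM MW] := row_free_basis (leqnn (\dim W)).
have mn : (\dim W <= n)%N.
  by have := dimvS (subvf W); rewrite dimvf /dim /= mul1n.
(* The first [\rank M] rows of this invertible matrix span the row space of [M], that is [W]. *)
pose g := row_ebase M.
have gu : g \in unitmx by exact: row_ebase_unit.
have gW (i : 'I_n) : (i < \dim W)%N -> row i g \in W.
  move=> im.
  have E : row i g = row (Ordinal im) (invmx (col_ebase M) *m M).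
    have -> : invmx (col_ebase M) *m M = pid_mx (\rank M) *m row_ebase M.
      by rewrite -{2}(mulmx_ebase M) -mulmxA mulKmx ?col_ebase_unit.
    have /eqP -> : \rank M == \dim W by [].
    rewrite row_mul (_ : row _ (pid_mx _) = delta_mx 0 i) -?rowE//.
    apply/rowP => j; rewrite !mxE eqxx /= im andbT.
    by rewrite eq_sym.
  by rewrite E row_mul; apply: memv_mulmx.
pose O := gram_schmidt g.
have Oo : O *m O^T = 1%:M by exact: gram_schmidt_orthogonal.
have OW (i : 'I_n) : (i < \dim W)%N -> row i O \in W.
  move=> im; have [c c0 ->] := gram_schmidt_span g mn im.
  apply: memv_mulmx => j cj; apply: gW; rewrite ltnNge; apply: contra cj.
  by move=> /c0 ->.
exists O => // x; split => [|[c c0 ->]]; last first.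
  apply: memv_mulmx => j cj; apply: OW; rewrite ltnNge; apply: contra cj.
  by move=> /c0 ->.
pose w := widen_ord mn.
(* Containment becomes equality by counting: the first [\dim W] rows of [O] are independent and lie
   in [W]. *)
have fO : row_free (rowsub w O).
  apply/row_free_kerP => c; rewrite rowsubE mulmxA => /(congr1 (mulmx^~ O^T)).
  rewrite -mulmxA Oo mulmx1 mul0mx => /rowP cw; apply/rowP => i.
  have := cw (w i); rewrite !mxE (bigD1 i)//= big1 => [|j ji].
    by rewrite !mxE eqxx mulr1 addr0.
  by rewrite !mxE (_ : (w j == w i) = false) ?mulr0//; exact/negbTE.
move=> /(row_free_span (erefl _) fO)[i|b ->].
  by rewrite row_rowsub; apply: OW => /=.
rewrite rowsubE mulmxA; exists (b *m rowsub w 1%:M) => // j mj.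
rewrite mxE big1// => i _; rewrite !mxE (_ : (w i == j) = false) ?mulr0//.
by apply/eqP => ij; move: mj; rewrite -ij /= leqNgt ltn_ord.
Qed.

(** The rotation carries an orthonormal basis adapted to [W] to one adapted to [W']. *)
Lemma rotate_transitive (W W' : {vspace 'rV[R]_n}) : \dim W = \dim W' ->
  exists2 O : 'M[R]_n, O *m O^T = 1%:M & W' = rotate O W.
Proof.
move=> dW; have [ O Oo OW] := orthonormal_adapted W.
have [ O' O'o OW'] := orthonormal_adapted W'.
have OtO : O^T *m O = 1%:M by exact: mulmx1C.
have OtO' : O'^T *m O' = 1%:M by exact: mulmx1C.
exists (O^T *m O').
  by rewrite trmx_mul trmxK mulmxA -(mulmxA _ O') O'o mulmx1.
apply/vspaceP => x; apply/idP/idP.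
  move=> /OW'[c c0 ->]; apply/memv_rotate; exists (c *m O).
    by apply/OW; exists c => // j; rewrite dW => /c0.
  by rewrite -mulmxA (mulmxA O) Oo mul1mx.
move=> /memv_rotate[y /OW[c c0 ->] ->]; apply/OW'; exists c.
  by move=> j; rewrite -dW => /c0.
by rewrite -mulmxA (mulmxA O) Oo mul1mx.
Qed.

End AdaptedBasis.

(** * Fubini for probabilities of sections *)

Section ProbabilityTools.
Context {R : realType}.
Local Open Scope ereal_scope.

Lemma integral_ae_cst d (T : measurableType d) (P : probability T R)
    (f : T -> \bar R) (c : \bar R) (N : set T) :
  measurable_fun setT f -> measurable N -> P N = 0 ->
  (forall x, ~ N x -> f x = c) -> \int[P]_x f x = c.
Proof.
move=> mf mN PN fc.
rewrite (@ae_eq_integral _ _ _ P setT (cst c))//.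
  apply: (etrans (@integral_cst _ _ _ P setT measurableT c)).
  by rewrite -[RHS]mule1; congr (_ * _); exact: probability_setT.
by exists N; split => // x /= /not_implyP[_ fxc]; apply: contrapT => /fc.
Qed.

Lemma measurable_section1 d1 d2 (T1 : measurableType d1) (T2 : measurableType d2)
    (P2 : probability T2 R) (A : set (T1 * T2)) : measurable A ->
  measurable_fun setT (fun x => P2 [set y | A (x, y)]).
Proof.
move=> mA; rewrite (_ : (fun x => _) = P2 \o xsection A).
  exact: measurable_fun_xsection.
by apply/funext => x /=; congr (P2 _); apply/seteqP; split => y; rewrite /xsection/= inE.
Qed.

Lemma measurable_section2 d1 d2 (T1 : measurableType d1) (T2 : measurableType d2)
    (P1 : probability T1 R) (A : set (T1 * T2)) : measurable A ->
  measurable_fun setT (fun y => P1 [set x | A (x, y)]).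
Proof.
move=> mA; rewrite (_ : (fun x => _) = P1 \o ysection A).
  exact: measurable_fun_ysection.
by apply/funext => x /=; congr (P1 _); apply/seteqP; split => y; rewrite /ysection/= inE.
Qed.

Lemma probability_fubini d1 d2 (T1 : measurableType d1) (T2 : measurableType d2)
    (P1 : probability T1 R) (P2 : probability T2 R) (A : set (T1 * T2)) :
  measurable A ->
  \int[P1]_x P2 [set y | A (x, y)] = \int[P2]_y P1 [set x | A (x, y)].
Proof.
move=> mA.
transitivity (\int[P1]_x (P2 \o xsection A) x).
  by apply: eq_integral => x _ /=; congr (P2 _); apply/seteqP; split => y; rewrite /xsection/= inE.
rewrite -(indic_fubini_tonelli_FE P2 mA) (@indic_fubini_tonelli _ _ _ _ _ P1 P2 _ mA).
rewrite (indic_fubini_tonelli_GE P1 mA).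
by apply: eq_integral => x _ /=; congr (P1 _); apply/seteqP; split => y; rewrite /ysection/= inE.
Qed.

End ProbabilityTools.

(** * Uniform subspaces *)

Section UniformLaw.
Context {R : realType} {n : nat}.
Local Notation bM m n := (borel 'M[R]_(m, n)).
Local Notation lin := (lin_subspace R n).
Local Open Scope ereal_scope.

(** Gram-Schmidt is equivariant on the right, whereas rotating first by [O] multiplies on the left
    in [rotate_mul]; the transpose reconciles the two. *)
Definition gs_rotation (g : bM n n) : bM n n := (gram_schmidt (g : 'M[R]_n))^T.

Lemma measurable_gs_rotation : measurable_fun setT gs_rotation.
Proof.
apply: measurable_fun_mx => i j; rewrite /gs_rotation; under eq_fun do rewrite mxE.
by apply: measurable_fun_mxE; exact: measurable_gram_schmidt.
Qed.

Lemma gs_rotation_equivariant (O g : 'M[R]_n) : O *m O^T = 1%:M ->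
  gs_rotation (g *m O^T) = O *m gs_rotation g.
Proof.
move=> Oo; rewrite /gs_rotation gram_schmidt_equivariant ?trmx_mul ?trmxK//.
exact: mulmx1C.
Qed.

(* Averaging over the random rotation [gs_rotation g], [g] Gaussian, turns any
   [uniform_law] into the law of a randomly rotated fixed subspace. *)
Lemma uniform_lawE m (mu : probability lin R) (E : {vspace 'rV[R]_n}) B :
  uniform_law m mu -> \dim E = m -> measurable B ->
  mu B = gmx n n [set g | B (rotate (gs_rotation g) E)].
Proof.
move=> [mudim murot] dE mB.
pose rot (z : bM n n * lin) := rotate (gs_rotation z.1) z.2.
have mrot : measurable_fun setT rot.
  exact: (measurable_rotate measurable_gs_rotation).
have mA : measurable (rot @^-1` B) by exact: measurable_preimage.
(* For almost every [g] the rotation is orthogonal, and invariance of [mu] makes the inner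
   probability the constant [mu B]. *)
transitivity (\int[gmx n n]_g mu [set W | (rot @^-1` B) (g, W)]).
  apply/esym; apply: (integral_ae_cst (N := [set g : bM n n | \det (g : 'M[R]_n) = 0%R])).
  - exact: measurable_section1.
  - exact: measurable_det_eq0.
  - exact: gmx_det_eq0.
  - move=> g /eqP g0.
    have Qo : (gs_rotation g *m (gs_rotation g)^T = 1%:M)%R.
      rewrite /gs_rotation trmxK; apply: mulmx1C; apply: gram_schmidt_orthogonal.
      by rewrite unitmxE unitfE.
    exact: (etrans _ (murot _ Qo _ mB)).
rewrite probability_fubini//.
apply: (integral_ae_cst (N := ~` [set W : lin | \dim (W : {vspace 'rV[R]_n}) = m])).
- exact: measurable_section2.
- by apply: measurableC; exact: measurable_dim_eq.
- rewrite probability_setC ?mudim ?subee//; exact: measurable_dim_eq.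
move=> W /contrapT dW.
(* [W] is a rotation of [E]; equivariance and the invariance of the Gaussian law absorb that
   rotation into [g]. *)
have [ O Oo WE] := @rotate_transitive R n E W (etrans dE (esym dW)).
have mS : measurable [set g : bM n n | B (rotate (gs_rotation g) E)].
  have mrotE : measurable_fun setT (fun g : bM n n => rot (g, (E : lin))).
    exact: (measurableT_comp mrot (pair2_measurable (E : lin))).
  exact: (measurable_preimage mrotE mB).
have Oto : (O^T *m O^T^T = 1%:M)%R by rewrite trmxK; exact: mulmx1C.
rewrite -[RHS](gmx_mulmxr Oto mS); congr (gmx n n _).
apply/seteqP; split => g; rewrite /rot /= WE gs_rotation_equivariant//;
  by rewrite -rotate_mul.
Qed.

Lemma uniform_law_unique m (mu nu : probability lin R) B :
  uniform_law m mu -> uniform_law m nu -> measurable B -> mu B = nu B.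
Proof.
move=> umu unu mB.
(* Without a subspace of dimension [m], the event to which [mu] gives mass 1 would be empty. *)
have [E dE] : exists E : {vspace 'rV[R]_n}, \dim E = m.
  apply: contrapT => nE; have := umu.1.
  rewrite (_ : [set W : lin | _] = set0) ?measure0.
    by move=> /eqP; rewrite eq_sym onee_eq0.
  by apply/seteqP; split => // W /= dW; apply: nE; exists W.
by rewrite (uniform_lawE umu dE mB) (uniform_lawE unu dE mB).
Qed.

(** Its invertibility is a sufficient condition for rank [m] that is read off one determinant and
    holds almost surely. *)
Definition top_block m (mn : (m <= n)%N) (A : 'M[R]_(n, m)) : 'M[R]_m :=
  mxsub (widen_ord mn) id A.

Lemma gmx_top_block_det0 m (mn : (m <= n)%N) :
  measurable [set A : bM n m | \det (top_block mn A) = 0%R] /\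
  gmx n m [set A : bM n m | \det (top_block mn A) = 0%R] = 0.
Proof.
split.
  apply: (measurable_preimage (f := fun A : bM n m => top_block mn A : bM m m)
    (A := [set M : bM m m | \det (M : 'M[R]_m) = 0%R])); last exact: measurable_det_eq0.
  apply: measurable_fun_mx => i j; under eq_fun do rewrite mxE.
  exact: measurable_entry.
rewrite -(@gmx_det_eq0 R m).
apply: (gmx_mxsub (f := widen_ord mn) (g := id) _ _ (@measurable_det_eq0 R m)) => //.
by move=> i j /(congr1 val)/= ij; apply: val_inj.
Qed.

Lemma top_block_dim m (mn : (m <= n)%N) (A : 'M[R]_(n, m)) :
  \det (top_block mn A) != 0%R ->
  \dim (row_kernel A : {vspace 'rV[R]_n}) = (n - m)%N.
Proof.
move=> dA; have uA : top_block mn A \in unitmx by rewrite unitmxE unitfE.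
pose f := linfun (mulmxr A) : 'Hom('rV[R]_n, 'rV[R]_m).
have lf : limg f = fullv.
  apply/vspaceP => y; rewrite memvf; apply/memv_imgP.
  (* A preimage of [y] supported on the first [m] coordinates, where [A] acts as its top block. *)
  exists (y *m invmx (top_block mn A) *m rowsub (widen_ord mn) 1%:M); first exact: memvf.
  rewrite lfunE /= -!mulmxA -rowsubE mulmxA.
  by rewrite (_ : rowsub _ _ = top_block mn A) ?mulmxKV.
have := limg_ker_dim f fullv; rewrite capfv lf !dimvf /dim /= !mul1n => E.
by apply/eqP; rewrite -(eqn_add2r m) [X in X == _]E subnK.
Qed.

(** For orthogonal [Q], [rotate Q (row_kernel A) = row_kernel (Q^T *m A)], so invariance is
    inherited from the law of [A]; the dimension is the generic one. *)
Lemma row_kernel_law m : (m <= n)%N ->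
  uniform_law (n - m) (image_prob (gmx n m) (@measurable_row_kernel R n m)).
Proof.
move=> mn; split => [|Q Qo B mB].
  rewrite image_probE.
  have mD : measurable ((fun A : bM n m => row_kernel (A : 'M[R]_(n, m))) @^-1`
      [set W : lin | \dim (W : {vspace 'rV[R]_n}) = (n - m)%N]).
    by apply: measurable_preimage; [exact: measurable_row_kernel|exact: measurable_dim_eq].
  have [mN N0] := gmx_top_block_det0 mn.
  apply/eqP; rewrite eq_le probability_le1//=.
  have <- : gmx n m (~` [set A : bM n m | \det (top_block mn A) = 0%R]) = 1.
    by rewrite probability_setC// N0 sube0.
  apply: le_measure; rewrite ?inE//; first exact: measurableC.
  by move=> A /eqP /top_block_dim.
have mS : measurable ((fun A : bM n m => row_kernel (A : 'M[R]_(n, m))) @^-1` B).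
  by apply: measurable_preimage => //; exact: measurable_row_kernel.
have Qto : (Q^T *m Q^T^T = 1%:M)%R by rewrite trmxK; exact: mulmx1C.
rewrite image_probE [RHS]image_probE.
rewrite -[RHS](gmx_mulmxl Qto mS); congr (gmx n m _).
have rotE (A : 'M[R]_(n, m)) : rotate Q (row_kernel A) = row_kernel (Q^T *m A).
  apply/vspaceP => x; apply/idP/idP.
    move=> /memv_rotate[y]; rewrite !mem_row_kernel => /eqP yA ->.
    by rewrite -mulmxA (mulmxA Q) Qo mul1mx yA.
  rewrite mem_row_kernel => /eqP xA; apply/memv_rotate; exists (x *m Q^T).
    by rewrite mem_row_kernel -mulmxA xA.
  by rewrite -mulmxA (mulmx1C Qo) mulmx1.
by apply/seteqP; split => A /=; rewrite rotE.
Qed.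

Lemma haar_row_kernel m B : (m <= n)%N -> measurable B ->
  haar R n (n - m) B = gmx n m [set A | B (row_kernel A)].
Proof.
move=> mn mB.
rewrite -[RHS](image_probE (gmx n m) (@measurable_row_kernel R n m)).
apply: uniform_law_unique mB; last exact: row_kernel_law.
rewrite /haar; apply: (@getPex _ (fun mu : probability lin R => uniform_law (n - m) mu)).
by eexists; exact: row_kernel_law mn.
Qed.

End UniformLaw.

(** * Cones over Gaussian images of a simplex *)

Section SimplexCones.
Context {R : realType} {n : nat}.
Local Notation bM m n := (borel 'M[R]_(m, n)).
Implicit Types (I : {set 'I_n}) (a : 'rV[R]_n).

(* The tangent cone of [Delta_n] at its face with vertex set [I]. *)
Definition simplex_cone I : set 'rV[R]_n :=
  [set a | \sum_i a 0 i = 0 /\ forall i, i \notin I -> 0 <= a 0 i].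

Definition meets_cone I m (M : 'M[R]_(n, m)) :=
  exists a, [/\ simplex_cone I a, a != 0 & a *m M = 0].

Definition affinely_free k (X : 'M[R]_(n, k)) :=
  forall a, \sum_i a 0 i = 0 -> a *m X = 0 -> a = 0.

Lemma sum_continuous : continuous (fun a => \sum_i a 0 i).
Proof.
move=> a; apply: cvg_big => [| |i _]; first exact: add_continuous.
  exact: nbhs_filter.
exact: coord_continuous.
Qed.

Lemma simplex_cone_closed I : closed (simplex_cone I).
Proof.
have -> : simplex_cone I = (fun a => \sum_i a 0 i) @^-1` [set 0] `&`
    \bigcap_(i in [set i | i \notin I]) ((fun a => a 0 i) @^-1` [set x | 0 <= x]).
  apply/seteqP; split => [a [a0 aI]|a [a0 aI]]; split => //.
apply: closedI.
  by apply: closed_comp => [a _|]; [exact: sum_continuous|exact: closed_eq].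
apply: closed_bigI => i _.
by apply: closed_comp => [a _|]; [exact: coord_continuous|exact: closed_ge].
Qed.

Lemma simplex_coneZ I (c : R) a : 0 <= c -> simplex_cone I a -> simplex_cone I (c *: a).
Proof.
move=> c0 [a0 aI]; split => [|i iI]; last by rewrite mxE mulr_ge0 ?aI.
by under eq_bigr do rewrite mxE; rewrite -mulr_sumr a0 mulr0.
Qed.

(** Rescaling provides a compact set of witnesses, as [kernel_meets_compact_closed] demands. *)
Lemma meets_cone_sphere I m (M : 'M[R]_(n, m)) :
  meets_cone I M <-> exists2 a, (simplex_cone I `&` @sphere R n) a & a *m M = 0.
Proof.
split => [[a [aI a0 aM]]|[a [aI a1] aM]]; last first.
  by exists a; split => //; exact: sphere_neq0.
exists (`|a|^-1 *: a); last by rewrite -scalemxAl aM scaler0.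
by split; [apply: simplex_coneZ; rewrite ?invr_ge0|exact: normalize_sphere].
Qed.

Lemma simplex_cone_sphere_compact I : compact (simplex_cone I `&` @sphere R n).
Proof.
rewrite setIC; apply: compact_closedI; first exact: sphere_compact.
exact: simplex_cone_closed.
Qed.

Lemma measurable_meets_cone I m : measurable [set M : bM n m | meets_cone I M].
Proof.
apply: borel_closed.
rewrite (_ : [set M | _] = [set M : 'M[R]_(n, m) |
    exists2 a, (simplex_cone I `&` @sphere R n) a & a *m M = 0]).
  exact/kernel_meets_compact_closed/simplex_cone_sphere_compact.
by apply/seteqP; split => M /meets_cone_sphere.
Qed.

Lemma measurable_mulmx_meets I k m :
  measurable [set z : bM n k * bM k m | meets_cone I (z.1 *m z.2 : 'M[R]_(n, m))].
Proof.
have mf : measurable_fun setT (fun z : bM n k * bM k m => z.1 *m z.2 : bM n m).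
  by apply: measurable_fun_mulmx; [exact: measurable_fst|exact: measurable_snd].
by have := measurable_preimage mf (@measurable_meets_cone I m).
Qed.

(** The event is a hit of the compact image [K] of the unit vectors of the cone; affine freeness
    keeps 0 out of [K], so that a hit is a nontrivial intersection. *)
Lemma grassmann_angle_cone I k j (X : 'M[R]_(n, k)) : (j <= k)%N ->
  affinely_free X ->
  grassmann_angle j [set a *m X | a in simplex_cone I] =
  fine (gmx k j [set A | meets_cone I (X *m (A : 'M[R]_(k, j)))]).
Proof.
move=> jk Xfree; rewrite /grassmann_angle; congr fine.
pose K := [set a *m X | a in simplex_cone I `&` @sphere R n].
have cK : compact K.
  apply: continuous_compact; last exact: simplex_cone_sphere_compact.
  exact/continuous_subspaceT/mulmxr_continuous.
have cone0 : simplex_cone I 0.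
  by split => [|i _]; rewrite ?mxE// big1// => i _; rewrite mxE.
have -> : [set W : lin_subspace R k | [set a *m X | a in simplex_cone I] `&` [set` W] <> [set 0]] = hits K.
  apply/seteqP; split => [W DW|W [_ [a [aI a1] <-]] Wa E].
    apply: contrapT => nKW; apply: DW; apply/seteqP; split => [y [[a aI <-] Wa]|_ ->].
      have [->|a0] := eqVneq a 0; first by rewrite /= mul0mx.
      exfalso; apply: nKW; exists (`|a|^-1 *: (a *m X)); last exact: memvZ.
      exists (`|a|^-1 *: a); last by rewrite scalemxAl.
      by split; [apply: simplex_coneZ; rewrite ?invr_ge0|exact: normalize_sphere].
    by split => /=; [exists 0; rewrite // mul0mx|exact: mem0v].
  have : [set 0] (a *m X) by rewrite -E; split => //=; exists a.
  by move=> /= aX; have := sphere_neq0 a1; rewrite (Xfree a aI.1 aX) eqxx.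
rewrite (haar_row_kernel jk (measurable_hits_compact cK)); congr (gmx k j _).
apply/seteqP; split => [A [_ [a aI <-]]|A /meets_cone_sphere[a aI aXA]].
  rewrite mem_row_kernel => /eqP aXA; apply/meets_cone_sphere; exists a => //.
  by rewrite mulmxA.
exists (a *m X); first by exists a.
by rewrite mem_row_kernel -mulmxA aXA.
Qed.

Lemma meets_cone_mulmx_unit I m (M : 'M[R]_(n, m)) (C : 'M[R]_m) : C \in unitmx ->
  meets_cone I (M *m C) <-> meets_cone I M.
Proof.
move=> Cu; split => -[a [aI a0 aM]]; exists a; split => //.
  by rewrite -[M](mulmxK Cu) mulmxA aM mul0mx.
by rewrite mulmxA aM mul0mx.
Qed.

End SimplexCones.

(** * Averaging over Gaussian matrices *)

Section Averages.
Context {R : realType}.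
Local Notation bM m n := (borel 'M[R]_(m, n)).

(** The factor with orthonormal columns consists of the first [j] columns of [O^T]. Keeping the
    square matrix [O] splits its action on a Gaussian [X] into an orthogonal change and a deletion
    of columns, both of known effect on the law. *)
Lemma full_rank_factor k j (jk : (j <= k)%N) (A : 'M[R]_(k, j)) :
  \det (top_block jk A) != 0 ->
  exists O : 'M[R]_k, exists2 C : 'M[R]_j, O *m O^T = 1%:M /\ C \in unitmx &
    forall n (X : 'M[R]_(n, k)), X *m A = colsub (widen_ord jk) (X *m O^T) *m C.
Proof.
move=> dA; have uA : top_block jk A \in unitmx by rewrite unitmxE unitfE.
have fA : row_free A^T.
  apply/row_free_kerP => c cA.
  have /(congr1 (mulmx (invmx (top_block jk A)))) : top_block jk A *m c^T = 0.
    have : A *m c^T = 0 by rewrite -[A]trmxK -trmx_mul cA trmx0.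
    rewrite (_ : top_block jk A = rowsub (widen_ord jk) A)//.
    by rewrite rowsubE -mulmxA => ->; rewrite mulmx0.
  by rewrite mulKmx// mulmx0 => /(congr1 trmx); rewrite trmxK trmx0.
pose W := <<[tuple row i A^T | i < j]>>%VS.
have dW : \dim W = j by have := fA; rewrite free_rows => /eqnP ->; rewrite size_tuple.
have [ O Oo OW] := orthonormal_adapted W.
(* This is [O *m A]; the columns of [A] lie in [W], so its rows from index [j] on vanish. *)
pose C0 := (A^T *m O^T)^T.
have C00 (l : 'I_k) i : (j <= l)%N -> C0 l i = 0.
  move=> jl; rewrite mxE; have : row i A^T \in W.
    by apply: memv_span; apply/mapP; exists i; rewrite ?mem_enum.
  move=> /OW[c c0 rE].
  have -> : (A^T *m O^T) i l = row i (A^T *m O^T) 0 l by rewrite [RHS]mxE.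
  by rewrite row_mul rE -mulmxA Oo mulmx1 c0// dW.
have AE : A = O^T *m C0.
  rewrite /C0 trmx_mul !trmxK mulmxA -[LHS]mul1mx; congr (_ *m _).
  by apply/esym/mulmx1C.
pose C := rowsub (widen_ord jk) C0.
have XA n (X : 'M[R]_(n, k)) : X *m A = colsub (widen_ord jk) (X *m O^T) *m C.
  rewrite {1}AE mulmxA; apply/matrixP => i r; rewrite [LHS]mxE [RHS]mxE.
  rewrite (bigID (fun l : 'I_k => (l < j)%N))/= [X in _ + X]big1 => [|l]; last first.
    by rewrite -leqNgt => /C00 ->; rewrite mulr0.
  rewrite addr0 (big_ord_narrow jk) /=; apply: eq_bigr => l _.
  by rewrite [colsub _ _ _ _]mxE [C _ _]mxE.
exists O, C => //; split => //; rewrite -unitmx_tr -row_free_unit.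
apply/row_free_kerP => c cC; apply: (row_free_kerP _ fA).
have : A *m c^T = 0.
  by rewrite -[A]mul1mx XA -mulmxA -[C]trmxK -trmx_mul cC trmx0 mulmx0.
by move=> /(congr1 trmx); rewrite trmx_mul trmxK trmx0.
Qed.

Lemma average_meets_cone n k j (I : {set 'I_n}) : (j <= k)%N ->
  (\int[gmx n k]_X gmx k j [set A | meets_cone I ((X : 'M[R]_(n, k)) *m (A : 'M[R]_(k, j)))])%E =
  gmx n j [set M : bM n j | meets_cone I M].
Proof.
move=> jk; rewrite (probability_fubini _ _ (@measurable_mulmx_meets R n I k j)).
have [mN N0] := @gmx_top_block_det0 R k j jk.
apply: (integral_ae_cst (N := [set A : bM k j | \det (top_block jk A) = 0])) => //.
  exact: measurable_section2 (@measurable_mulmx_meets R n I k j).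
move=> A /eqP /full_rank_factor[ O [C [Oo Cu] XA]].
have mK := @measurable_meets_cone R n I j.
have wI : injective (widen_ord jk).
  by move=> i i' /(congr1 val)/= ii'; apply: val_inj.
rewrite -[RHS](gmx_mxsub (f := id) _ wI mK)//.
have msub : measurable_fun setT (fun X : bM n k => colsub (widen_ord jk) X : bM n j).
  apply: measurable_fun_mx => i l; under eq_fun do rewrite mxE.
  exact: measurable_entry.
have Oto : O^T *m O^T^T = 1%:M by rewrite trmxK; exact: mulmx1C.
rewrite -[RHS](gmx_mulmxr Oto (measurable_preimage msub mK)).
by congr (gmx n k _); apply/seteqP; split => X /=; rewrite XA => /(meets_cone_mulmx_unit _ _ Cu).
Qed.

(** An orthogonal change of coordinates sends the all-ones direction to the first axis, so
    coordinate sum 0 becomes first coordinate 0. What is left is injectivity of a Gaussian [n] by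
    [k] matrix, ensured by one invertible [n] by [n] block. *)
Lemma affinely_free_ae n k : (n <= k)%N ->
  exists N : set (bM n.+1 k), [/\ measurable N, gmx n.+1 k N = 0%E &
    forall X, ~ N X -> affinely_free (X : 'M[R]_(n.+1, k))].
Proof.
move=> nk; pose one : 'rV[R]_n.+1 := const_mx 1.
have one0 : one != 0.
  by apply/eqP => /rowP/(_ 0); rewrite !mxE => /eqP; rewrite oner_eq0.
have [ O Oo OW] := orthonormal_adapted <[one]>%VS.
have dim1 : \dim <[one]> = 1%N by rewrite dim_vline one0.
have [c c0 oneE] : span_rows O 1 one by rewrite -dim1; apply/OW; exact: memv_line.
have sumE (a : 'rV[R]_n.+1) : \sum_i a 0 i = c 0 0 * (a *m O^T) 0 0.
  have -> : \sum_i a 0 i = dotr a one.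
    by rewrite dotrE; apply: eq_bigr => i _; rewrite mxE mulr1.
  rewrite oneE /dotr trmx_mul mulmxA mxE (bigD1 0)//= big1 => [|i i0].
    by rewrite addr0 mulrC [_^T _ _]mxE.
  by rewrite [_^T _ _]mxE c0 ?mulr0// lt0n.
have c00 : c 0 0 != 0.
  apply: contraNneq one0 => c00; rewrite oneE (_ : c = 0) ?mul0mx//.
  apply/rowP => i; rewrite mxE; have [->//|i0] := eqVneq i 0.
  by apply: c0; rewrite lt0n.
pose D (X : bM n.+1 k) : bM n n := mxsub (lift 0) (widen_ord nk) (X : 'M[R]_(n.+1, k)).
have mD : measurable_fun setT D.
  apply: measurable_fun_mx => i l; rewrite /D; under eq_fun do rewrite mxE.
  exact: measurable_entry.
have mN0 : measurable (D @^-1` [set M : bM n n | \det (M : 'M[R]_n) = 0]).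
  exact: measurable_preimage mD (@measurable_det_eq0 R n).
exists ((fun X : bM n.+1 k => O *m (X : 'M[R]_(n.+1, k)) : bM n.+1 k) @^-1`
  (D @^-1` [set M : bM n n | \det (M : 'M[R]_n) = 0])).
split.
- by apply: measurable_preimage => //; exact: measurable_mulmxl.
- rewrite (gmx_mulmxl Oo mN0) -[RHS](@gmx_det_eq0 R n).
  apply: (gmx_mxsub (f := lift 0) (g := widen_ord nk) _ _ (@measurable_det_eq0 R n)).
    exact: lift_inj.
  by move=> i i' /(congr1 val)/= ii'; apply: val_inj.
move=> X /eqP /= dX a a0 aX.
pose b := a *m O^T.
have b0 : b 0 0 = 0.
  by move: a0; rewrite sumE => /eqP; rewrite mulf_eq0 (negbTE c00) => /eqP.
have aE : a = b *m O by rewrite -mulmxA (mulmx1C Oo) mulmx1.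
pose b' : 'rV[R]_n := \row_i b 0 (lift 0 i).
have bD : b' *m D (O *m X) = 0.
  apply/rowP => l; rewrite [RHS]mxE.
  have : (b *m (O *m X)) 0 (widen_ord nk l) = 0 by rewrite mulmxA -aE aX mxE.
  rewrite mxE big_ord_recl b0 mul0r add0r => bOX.
  by rewrite mxE -[RHS]bOX; apply: eq_bigr => i _; rewrite [b' _ _]mxE [D _ _ _]mxE.
have b'0 : b' = 0.
  by rewrite -[b'](@mulmxK _ _ _ (D (O *m X))) ?bD ?mul0mx// unitmxE unitfE.
rewrite aE (_ : b = 0) ?mul0mx//; apply/rowP => i; rewrite [RHS]mxE.
case: (unliftP 0 i) => [i' ->|->//].
by move: b'0 => /rowP/(_ i'); rewrite !mxE.
Qed.

End Averages.

(** * Faces and tangent cones of a simplex *)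

Section SimplexFaces.
Context {R : realType} {n k : nat}.
Variables (p : 'I_n -> 'rV[R]_k).
Let X : 'M[R]_(n, k) := \matrix_i p i.
Hypothesis Xfree : affinely_free X.
Implicit Types (I : {set 'I_n}) (a : 'rV[R]_n).
Local Notation P := (conv_hull p).

Definition bary I : set 'rV[R]_n :=
  [set a | [/\ forall i, 0 <= a 0 i, \sum_i a 0 i = 1
          & forall i, i \notin I -> a 0 i = 0]].

Definition subsimplex I : set 'rV[R]_k := [set a *m X | a in bary I].

Lemma sum_rowD a (b : 'rV[R]_n) : \sum_i (a + b) 0 i = \sum_i a 0 i + \sum_i b 0 i.
Proof. by rewrite -big_split/=; apply: eq_bigr => i _; rewrite mxE. Qed.

Lemma sum_rowZ (c : R) a : \sum_i (c *: a) 0 i = c * \sum_i a 0 i.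
Proof. by rewrite mulr_sumr; apply: eq_bigr => i _; rewrite mxE. Qed.

Lemma sum_rowB a (b : 'rV[R]_n) : \sum_i (a - b) 0 i = \sum_i a 0 i - \sum_i b 0 i.
Proof. by rewrite -scaleN1r sum_rowD sum_rowZ mulN1r. Qed.

Lemma comb_mulmx (b : 'I_n -> R) : \sum_i b i *: p i = (\row_i b i) *m X.
Proof. by rewrite mulmx_sum_row; apply: eq_bigr => i _; rewrite mxE rowK. Qed.

Lemma conv_hullE : P = subsimplex [set: 'I_n]%SET.
Proof.
apply/seteqP; split => [x [b [b0 b1 ->]]|_ [a [a0 a1 _] <-]].
  exists (\row_i b i); last by rewrite comb_mulmx.
  split => [i||i]; [by rewrite mxE| |by rewrite inE].
  by rewrite -b1; apply: eq_bigr => i _; rewrite mxE.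
exists (fun i => a 0 i); split => //; rewrite comb_mulmx; congr (_ *m _).
by apply/rowP => i; rewrite mxE.
Qed.

Lemma bary_inj a (b : 'rV[R]_n) : \sum_i a 0 i = \sum_i b 0 i -> a *m X = b *m X -> a = b.
Proof.
move=> ab aXbX; apply/eqP; rewrite -subr_eq0; apply/eqP; apply: Xfree.
  under eq_bigr do rewrite !mxE.
  by rewrite sumrB ab subrr.
by rewrite mulmxBl aXbX subrr.
Qed.

(** Affine independence says that [X] with an extra column of ones has independent rows, hence a
    right inverse. *)
Lemma affine_functional (w : 'I_n -> R) : exists u v, forall i, dotv u (p i) + v = w i.
Proof.
have fX : row_free (row_mx X (const_mx 1 : 'cV[R]_n)).
  apply/row_free_kerP => c; rewrite mul_mx_row -row_mx0 => /eq_row_mx[cX c1].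
  apply: Xfree => //; move: c1 => /rowP/(_ 0); rewrite !mxE => c1.
  by rewrite -[RHS]c1; apply: eq_bigr => i _; rewrite mxE mulr1.
have [B XB] := row_freeP fX.
pose u := B *m (\col_i w i).
have uE : X *m usubmx u + const_mx 1 *m dsubmx u = \col_i w i.
  by rewrite -mul_row_col vsubmxK mulmxA XB mul1mx.
exists (usubmx u)^T, (dsubmx u 0 0) => i.
move: uE => /colP/(_ i); rewrite [RHS]mxE => <-; rewrite [RHS]mxE; congr (_ + _).
  by rewrite /dotv [RHS]mxE; apply: eq_bigr => c _; rewrite [X i c]mxE [_^T _ _]mxE mulrC.
by rewrite [RHS]mxE big_ord1 [const_mx _ _ _]mxE mul1r.
Qed.

Lemma dotv_comb u a v : \sum_i a 0 i = 1 ->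
  dotv u (a *m X) + v = \sum_i a 0 i * (dotv u (p i) + v).
Proof.
move=> a1; under [RHS]eq_bigr do rewrite mulrDr.
rewrite big_split/= -mulr_suml a1 mul1r; congr (_ + _).
rewrite /dotv; under [LHS]eq_bigr do rewrite mxE mulr_sumr.
rewrite exchange_big/=; apply: eq_bigr => i _; rewrite mulr_sumr.
by apply: eq_bigr => j _; rewrite mxE mulrCA.
Qed.

Lemma vertex_comb i : (delta_mx 0 i : 'rV[R]_n) *m X = p i.
Proof. by rewrite -rowE rowK. Qed.

Lemma sum_delta i : \sum_j (delta_mx 0 i : 'rV[R]_n) 0 j = 1.
Proof.
rewrite (bigD1 i)//= big1 => [|j ji]; first by rewrite mxE !eqxx addr0.
by rewrite mxE (negbTE ji) andbF.
Qed.

Lemma subsimplex_vertex I i : subsimplex I (p i) <-> i \in I.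
Proof.
split => [[a [a0 a1 aI] ap]|iI].
  apply: contraT => iI; have : a = delta_mx 0 i.
    by apply: bary_inj; rewrite ?sum_delta ?vertex_comb.
  by move=> /rowP/(_ i); rewrite aI// mxE !eqxx => /esym/eqP; rewrite oner_eq0.
exists (delta_mx 0 i); last exact: vertex_comb.
split => [j||j jI]; [by rewrite mxE ler0n|exact: sum_delta|].
by rewrite mxE eqxx /=; case: eqP jI => [->|//]; rewrite iI.
Qed.

Lemma subsimplex_inj : injective subsimplex.
Proof.
move=> I J IJ; apply/setP => i; apply/idP/idP => /subsimplex_vertex.
  by rewrite IJ => /subsimplex_vertex.
by rewrite -IJ => /subsimplex_vertex.
Qed.

(** The vertex set consists of the vertices where the functional equals [c]: at a point of the face,
    the nonpositive terms [a_i (u . p_i - c)] sum to 0, so each vanishes. *)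
Lemma face_subsimplex F : is_face P F -> exists I, F = subsimplex I.
Proof.
move=> [u [c [Pc ->]]]; exists [set i | dotv u (p i) == c]%SET.
have pc i : dotv u (p i) <= c.
  by apply: Pc; rewrite conv_hullE; apply/subsimplex_vertex; rewrite inE.
have uE a : \sum_i a 0 i = 1 ->
    dotv u (a *m X) - c = \sum_i a 0 i * (dotv u (p i) - c).
  by move=> a1; rewrite dotv_comb.
apply/seteqP; split => [x []|_ [a [a0 a1 aI] <-]].
  rewrite conv_hullE => -[a [a0 a1 _] <-] uac; exists a => //; split => // i.
  rewrite inE => ic; move: (uE _ a1); rewrite uac subrr => /esym/eqP.
  rewrite -oppr_eq0 -sumrN psumr_eq0 => [/allP/(_ i)|j _]; last first.
    by rewrite -mulrN mulr_ge0// oppr_ge0 subr_le0.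
  rewrite mem_index_enum => /(_ isT); rewrite /= oppr_eq0 mulf_eq0 subr_eq0 (negbTE ic) orbF.
  by move/eqP.
split; first by rewrite conv_hullE; exists a => //; split => // i; rewrite inE.
apply/eqP; rewrite -subr_eq0 uE// big1// => i _.
have [|iI] := boolP (i \in [set i | dotv u (p i) == c]%SET).
  by rewrite inE => /eqP ->; rewrite subrr mulr0.
by rewrite aI// mul0r.
Qed.

Lemma subsimplex_face I : is_face P (subsimplex I).
Proof.
(* The functional is the total barycentric weight on [I]; it is at most 1, with equality exactly on
   the face. *)
have [u [v uv]] := affine_functional (fun i => (i \in I)%:R).
have uE a : \sum_i a 0 i = 1 -> dotv u (a *m X) + v = \sum_(i in I) a 0 i.
  move=> a1; rewrite dotv_comb// [RHS]big_mkcond/=; apply: eq_bigr => i _.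
  by rewrite uv; case: (i \in I); rewrite ?mulr1 ?mulr0.
have leI a : (forall i, 0 <= a 0 i) -> \sum_(i in I) a 0 i <= \sum_i a 0 i.
  by move=> a0; rewrite [leRHS](bigID (mem I))/= lerDl sumr_ge0.
exists u, (1 - v); split => [x|].
  rewrite conv_hullE => -[a [a0 a1 _] <-].
  by rewrite lerBrDr uE// -[leRHS]a1 leI.
apply/seteqP; split => [_ [a [a0 a1 aI] <-]|x [+ uxv]].
  split; first by rewrite conv_hullE; exists a => //; split => // i; rewrite inE.
  apply/eqP; rewrite -(inj_eq (addIr v)) subrK uE//.
  by rewrite -[in eqbRHS]a1 [in eqbRHS](bigID (mem I))/= [X in _ + X]big1 ?addr0.
rewrite conv_hullE => -[a [a0 a1 _] ax]; exists a => //; split => // i iI.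
have aI1 : \sum_(i in I) a 0 i = 1 by rewrite -uE// ax uxv subrK.
have /eqP : \sum_(i | i \notin I) a 0 i = 0.
  have := a1; rewrite (bigID (mem I))/= aI1 => /eqP.
  by rewrite -subr_eq0 addrAC subrr add0r => /eqP.
rewrite psumr_eq0// => /allP/(_ i); rewrite mem_index_enum iI => /(_ isT) /eqP.
exact.
Qed.

Definition face_direction I : set 'rV[R]_k :=
  [set a *m X | a in [set a : 'rV[R]_n | \sum_i a 0 i = 0 /\
                                        forall i, i \notin I -> a 0 i = 0]].

Lemma aff_hull_subsimplex I :
  aff_hull (subsimplex I) = [set a *m X | a in [set a : 'rV[R]_n |
     \sum_i a 0 i = 1 /\ forall i, i \notin I -> a 0 i = 0]].
Proof.
apply/seteqP; split => [x [m [b [q [qI b1 ->]]]]|_ [a [a1 aI] <-]].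
  have /fin_all_exists2[c cI cq] i : exists2 a, bary I a & a *m X = q i by exact: qI.
  exists (\sum_i b i *: c i); last first.
    by rewrite mulmx_suml; apply: eq_bigr => i _; rewrite -scalemxAl cq.
  split => [|l lI]; last first.
    rewrite summxE big1// => i _; rewrite mxE; have [_ _ ->//] := cI i.
    by rewrite mulr0.
  under eq_bigr do rewrite summxE; rewrite exchange_big/= -[RHS]b1.
  apply: eq_bigr => i _; under eq_bigr do rewrite mxE.
  by rewrite -mulr_sumr; have [_ -> _] := cI i; rewrite mulr1.
have [i0 i0I] : exists i0, i0 \in I.
  apply: contrapT => nI; have := a1; rewrite big1 => [/eqP|i _].
    by rewrite eq_sym oner_eq0.
  by apply: aI; apply/negP => iI; apply: nI; exists i.
(* Vertices outside [I] have coefficient 0; [p i0] replaces them so that every point used lies in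
   the face. *)
exists n, (fun i => a 0 i), (fun i => if i \in I then p i else p i0); split => //.
  by move=> i; case: ifP => iI; apply/subsimplex_vertex.
rewrite mulmx_sum_row; apply: eq_bigr => i _; rewrite rowK.
by case: ifPn => // /aI ->; rewrite !scale0r.
Qed.

Lemma face_direction_vspace I i0 : i0 \in I ->
  exists2 L : {vspace 'rV[R]_k}, \dim L = #|I|.-1 &
    forall x, x \in L <-> face_direction I x.
Proof.
move=> i0I; pose J := I :\ i0.
have cJ : #|J| = #|I|.-1 by rewrite (cardsD1 i0 I) i0I.
(* The edges from [i0] in barycentric coordinates, one for each other vertex of [I]. *)
pose B : 'M[R]_(#|J|, n) := \matrix_r (delta_mx 0 (enum_val r) - delta_mx 0 i0).
have BE r i : B r i = (i == enum_val r)%:R - (i == i0)%:R by rewrite !mxE.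
have Bsum (c : 'rV[R]_#|J|) : \sum_i (c *m B) 0 i = 0.
  under eq_bigr do rewrite mxE; rewrite exchange_big/= big1// => r _.
  rewrite -mulr_sumr; under eq_bigr do rewrite BE.
  rewrite sumrB (bigD1 (enum_val r))//= big1 => [|i /negbTE ->//].
  rewrite (bigD1 i0)//= big1 => [|i /negbTE ->//].
  by rewrite !eqxx !addr0 subrr mulr0.
have BJ (c : 'rV[R]_#|J|) r : (c *m B) 0 (enum_val r) = c 0 r.
  have rJ := enum_valP r; move: (rJ); rewrite !inE => /andP[/negbTE ri0 _].
  rewrite mxE (bigD1 r)//= big1 => [|s sr].
    by rewrite BE eqxx ri0 subr0 mulr1 addr0.
  by rewrite BE ri0 (inj_eq enum_val_inj) eq_sym (negbTE sr) subr0 mulr0.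
have BI (c : 'rV[R]_#|J|) i : i \notin I -> (c *m B) 0 i = 0.
  move=> iI; rewrite mxE big1// => r _; rewrite BE.
  have -> : (i == i0) = false by apply/eqP => ii0; move: iI; rewrite ii0 i0I.
  have -> : (i == enum_val r) = false.
    apply/eqP => ir; have := enum_valP r; rewrite -ir !inE.
    by rewrite (negbTE iI) andbF.
  by rewrite subr0 mulr0.
have fBX : row_free (B *m X).
  apply/row_free_kerP => c; rewrite mulmxA => /(Xfree (Bsum c)) cB0.
  by apply/rowP => r; rewrite -BJ cB0 !mxE.
pose L := <<[tuple row r (B *m X) | r < #|J|]>>%VS.
have dL : \dim L = #|J| by have := fBX; rewrite free_rows => /eqnP ->; rewrite size_tuple.
have rL r : row r (B *m X) \in L.
  by apply: memv_span; apply/mapP; exists r; rewrite ?mem_enum.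
exists L; first by rewrite dL.
move=> x; split => [xL|[a [a0 aI] <-]].
  have [b ->] := row_free_span (esym dL) fBX rL xL.
  exists (b *m B); last by rewrite mulmxA.
  by split => // i; exact: BI.
pose b : 'rV[R]_#|J| := \row_r a 0 (enum_val r).
suff -> : a = b *m B by rewrite -mulmxA; exact: memv_mulmx.
have ab i : i != i0 -> a 0 i = (b *m B) 0 i.
  move=> ii0; have [iI|iI] := boolP (i \in I); last by rewrite aI// BI.
  have iJ : i \in J by rewrite !inE ii0.
  by rewrite -(enum_rankK_in iJ iJ) BJ mxE.
apply/rowP => i; have [->|/ab//] := eqVneq i i0.
have : \sum_i a 0 i = \sum_i (b *m B) 0 i by rewrite a0 Bsum.
rewrite (bigD1 i0)//= [in RHS](bigD1 i0)//= (eq_bigr _ ab).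
exact: addIr.
Qed.

Lemma subsimplex_affdim I l : has_affdim (subsimplex I) l <-> #|I| = l.+1.
Proof.
have [->|[i0 i0I]] := set_0Vmem I.
  rewrite cards0; split => // -[x0 [L [_ E]]].
  have : [set x | x - x0 \in L] x0 by rewrite /= subrr mem0v.
  rewrite -E aff_hull_subsimplex => -[a [a1 a0] _].
  by move: a1; rewrite big1 => [/eqP|i _]; rewrite ?a0 ?inE// eq_sym oner_eq0.
have I0 : (0 < #|I|)%N by apply/card_gt0P; exists i0.
have [L dL LE] := face_direction_vspace i0I.
have E : aff_hull (subsimplex I) = [set x | x - p i0 \in L].
  rewrite aff_hull_subsimplex; apply/seteqP; split => [_ [a [a1 aI] <-]|x /LE[a [a0 aI] ax]].
    apply/LE; exists (a - delta_mx 0 i0); last by rewrite mulmxBl vertex_comb.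
    split => [|i iI]; first by rewrite sum_rowB a1 sum_delta subrr.
    rewrite !mxE aI// sub0r (_ : (i == i0) = false) ?andbF ?oppr0//.
    by apply/eqP => ii0; move: iI; rewrite ii0 i0I.
  exists (a + delta_mx 0 i0); last by rewrite mulmxDl vertex_comb ax subrK.
  split => [|i iI]; first by rewrite sum_rowD a0 sum_delta add0r.
  rewrite !mxE aI// add0r (_ : (i == i0) = false) ?andbF//.
  by apply/eqP => ii0; move: iI; rewrite ii0 i0I.
split => [[x0 [L' [dL' E']]]|cI]; last by exists (p i0), L; rewrite dL cI.
(* [has_affdim] allows any base point and direction space; the affine hull determines the latter. *)
have LL' : L' = L.
  have x0L : x0 - p i0 \in L.
    have : [set x | x - x0 \in L'] x0 by rewrite /= subrr mem0v.
    by rewrite -E' E.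
  apply/vspaceP => y.
  have : [set x | x - x0 \in L'] (x0 + y) <-> [set x | x - p i0 \in L] (x0 + y).
    by rewrite -E' E.
  rewrite /= addrAC subrr add0r addrAC => H.
  by apply/idP/idP => [/H|yL]; [rewrite rpredDl|apply/H; rewrite rpredDl].
by rewrite -dL' LL' dL prednK.
Qed.

Lemma faces_simplex l : faces l P = [set subsimplex I | I in [set I : {set 'I_n} | #|I| = l.+1]].
Proof.
apply/seteqP; split => [F [/face_subsimplex[I ->] /subsimplex_affdim cI]|_ [I cI <-]].
  by exists I.
by split; [exact: subsimplex_face|exact/subsimplex_affdim].
Qed.

Lemma dotv_continuous (u : 'rV[R]_k) : continuous (dotv u).
Proof.
move=> x; apply: cvg_big => [| |i _]; first exact: add_continuous.
  exact: nbhs_filter.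
apply: (@cvgM _ _ (nbhs x) _ (fun=> u 0 i) (fun y : 'rV[R]_k => y 0 i)).
  exact: cvg_cst.
exact: coord_continuous.
Qed.

Definition barycenter I : 'rV[R]_n := \row_i ((i \in I)%:R / #|I|%:R).

Lemma sum_barycenter I : (0 < #|I|)%N -> \sum_i barycenter I 0 i = 1.
Proof.
move=> I0; under eq_bigr do rewrite mxE; rewrite -mulr_suml.
rewrite (_ : \sum_i _ = #|I|%:R) ?divff// ?pnatr_eq0 -?lt0n//.
rewrite -sum1_card natr_sum [RHS]big_mkcond/=; apply: eq_bigr => i _.
by case: (i \in I).
Qed.

(** Barycentric coordinates extend to continuous affine functionals on the ambient space, so the
    positive ones stay positive nearby. *)
Lemma barycenter_relint I : (0 < #|I|)%N ->
  relint (subsimplex I) (barycenter I *m X).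
Proof.
move=> I0; have cI0 : (0 : R) < #|I|%:R by rewrite ltr0n.
pose f := barycenter I.
have f1 : \sum_i f 0 i = 1 by exact: sum_barycenter.
have fI i : i \notin I -> f 0 i = 0 by rewrite mxE => /negbTE ->; rewrite mul0r.
split.
  by exists f => //; split => // i; rewrite mxE divr_ge0// ler0n.
have near_pos i : i \in I -> \forall y \near f *m X,
    forall a, \sum_i a 0 i = 1 -> y = a *m X -> 0 < a 0 i.
  move=> iI; have [u [v uv]] := affine_functional (fun j => (j == i)%:R).
  have uE a : \sum_i a 0 i = 1 -> dotv u (a *m X) + v = a 0 i.
    move=> a1; rewrite dotv_comb// (bigD1 i)//= uv eqxx mulr1 big1 ?addr0// => j ji.
    by rewrite uv (negbTE ji) mulr0.
  have cont : {for f *m X, continuous (fun y => dotv u y + v)}.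
    apply: (@cvgD _ _ _ (nbhs (f *m X)) _ (dotv u) (fun=> v)).
      exact: dotv_continuous.
    exact: cvg_cst.
  have : \forall y \near f *m X, 0 < dotv u y + v.
    apply: (cvgr_gt _ cont).
    by rewrite uE// mxE iI divr_gt0.
  by apply: filterS => y uy a a1 ya; rewrite -uE// -ya.
pose Q (i : 'I_n) (y : 'rV[R]_k) : Prop :=
  i \in I -> forall a, \sum_i a 0 i = 1 -> y = a *m X -> 0 < a 0 i.
have : \forall y \near f *m X, forall i, Q i y.
  apply: (@filter_forall _ _ Q _ (nbhs_filter _)) => i.
  have [iI|iI] := boolP (i \in I).
    by have := near_pos i iI; apply: filterS => y Hy _.
  by apply: nearW => y; rewrite /Q (negbTE iI).
apply: filterS => y Hy; rewrite aff_hull_subsimplex => -[a [a1 aI] ay].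
exists a => //; split => // i; have [iI|/aI ->//] := boolP (i \in I).
exact/ltW/Hy.
Qed.

Lemma tangent_cone_simplex I : (0 < #|I|)%N ->
  tangent_cone (subsimplex I) P = [set a *m X | a in simplex_cone I].
Proof.
move=> I0; have cI0 : (0 : R) < #|I|%:R by rewrite ltr0n.
apply/seteqP; split => [y [_ [e [[[b [b0 b1 bI] <-] _] e0]]]|_ [c [c0 cI] <-]].
  rewrite conv_hullE => -[a [a0 a1 _] aE].
  exists (e^-1 *: (a - b)).
    split => [|i iI].
      by rewrite sum_rowZ sum_rowB a1 b1 subrr mulr0.
    by rewrite !mxE bI// subr0 mulr_ge0// invr_ge0 ltW.
  by rewrite -scalemxAl mulmxBl aE addrAC subrr add0r scalerA mulVf ?scale1r// gt_eqF.
pose f := barycenter I.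
have f1 : \sum_i f 0 i = 1 by exact: sum_barycenter.
(* On [I] the barycentre has coordinates [1 / #|I|], and [S] bounds every [|c_i|], so a step of
   [1 / (#|I| S)] keeps these coordinates nonnegative. *)
pose S := 1 + \sum_i `|c 0 i|.
have S0 : 0 < S by rewrite ltr_wpDr// sumr_ge0.
pose e := (#|I|%:R * S)^-1.
have e0 : 0 < e by rewrite invr_gt0 mulr_gt0.
exists (f *m X), e; split => //; first exact: barycenter_relint.
rewrite conv_hullE; exists (f + e *: c); last by rewrite mulmxDl scalemxAl.
split => [i||i]; last by rewrite inE.
  rewrite !mxE; have [iI|iI] := boolP (i \in I); last first.
    by rewrite mul0r add0r mulr_ge0 ?cI// ltW.
  suff H : 0 <= 1 + S^-1 * c 0 i.
    by rewrite mul1r /e invfM -mulrA -[X in X + _]mulr1 -mulrDr mulr_ge0// invr_ge0 ler0n.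
  have -> : 1 + S^-1 * c 0 i = S^-1 * (S + c 0 i).
    by rewrite mulrDr mulVf// gt_eqF.
  rewrite mulr_ge0 ?invr_ge0 ?(ltW S0)//.
  rewrite -lerBlDr sub0r (le_trans _ (_ : `|c 0 i| <= S))//; last first.
    by rewrite /S (bigD1 i)//= addrCA lerDl addr_ge0// sumr_ge0.
  by rewrite lerNl lerNnormlW.
by rewrite sum_rowD sum_rowZ f1 c0 mulr0 addr0.
Qed.

End SimplexFaces.

(** * Expectation of the angle sums *)

Section NonmeasurableIntegrand.
Local Open Scope ereal_scope.
Context d (T : measurableType d) (R : realType) (mu : {measure set T -> \bar R}).

Import HBNNSimple.

(** Every simple function below [f] is below [g], and the integrals are suprema over such
    functions. *)
Lemma le_integral_nonmeasurable (f g : T -> \bar R) :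
  (forall x, 0 <= f x) -> (forall x, f x <= g x) ->
  \int[mu]_x f x <= \int[mu]_x g x.
Proof.
move=> f0 fg; have g0 x : 0 <= g x by exact: le_trans (fg x).
rewrite !ge0_integralTE//; apply: ereal_sup_le => _ [h hf <-].
by exists h => // x; exact: le_trans (fg x).
Qed.

(* [f] need not be measurable: the integral of a non-negative function is the
   supremum of the integrals of the simple functions below it. *)
Lemma integral_ae_nonmeasurable (f g : T -> \bar R) (N : set T) :
  (forall x, 0 <= f x) -> (forall x, 0 <= g x) -> measurable_fun setT g ->
  measurable N -> mu N = 0 -> (forall x, ~ N x -> f x = g x) ->
  \int[mu]_x f x = \int[mu]_x g x.
Proof.
move=> f0 g0 mg mN N0 fg.
(* [lo] and [hi] replace [g] on [N] by 0 and [+oo]: they are measurable, enclose [f], and have the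
   integral of [g]. *)
pose lo x := g x * (\1_(~` N) x)%:E.
pose hi x := g x + +oo * (\1_N x)%:E.
have mlo : measurable_fun setT lo.
  apply: emeasurable_funM => //; apply/measurable_EFinP/measurable_indic.
  exact: measurableC.
have mhi : measurable_fun setT hi.
  apply: emeasurable_funD => //; apply: emeasurable_funM => //.
  exact/measurable_EFinP/measurable_indic.
have loE x : ~ N x -> lo x = g x.
  by move=> Nx; rewrite /lo indicE mem_set// mule1.
have hiE x : ~ N x -> hi x = g x.
  by move=> Nx; rewrite /hi indicE memNset// mule0 adde0.
have intE h : measurable_fun setT h -> (forall x, ~ N x -> h x = g x) ->
    \int[mu]_x h x = \int[mu]_x g x.
  move=> mh hg; apply: ae_eq_integral => //; exists N; split => // x /= hx.
  by apply: contrapT => Nx; apply: hx => _; exact: hg.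
apply/eqP; rewrite eq_le; apply/andP; split.
  rewrite -(intE hi mhi hiE); apply: le_integral_nonmeasurable => // x.
  have [Nx|Nx] := pselect (N x); last by rewrite hiE// fg.
  by rewrite /hi indicE mem_set// mule1 addey ?leey// gt_eqF// (lt_le_trans _ (g0 x)).
rewrite -(intE lo mlo loE); apply: le_integral_nonmeasurable => x.
  by rewrite mule_ge0// lee_fin.
have [Nx|Nx] := pselect (N x); last by rewrite loE// fg.
by rewrite /lo indicE memNset ?mule0// => /(_ Nx).
Qed.

End NonmeasurableIntegrand.

Section AngleSums.
Context {R : realType}.
Local Notation bM m n := (borel 'M[R]_(m, n)).

Definition face_vertex_sets n l : seq {set 'I_n} :=
  enum [pred I : {set 'I_n} | #|I| == l.+1].

(** Faces are reindexed by their vertex sets, which [subsimplex_inj] makes one-to-one, and each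
    angle is then read off a Gaussian matrix. *)
Lemma angle_sum_simplex n k (p : 'I_n -> 'rV[R]_k) l j : (j <= k)%N ->
  affinely_free (\matrix_i p i) ->
  angle_sum l j (conv_hull p) = \sum_(I <- face_vertex_sets n l)
    fine (gmx k j [set A | meets_cone I ((\matrix_i p i) *m (A : 'M[R]_(k, j)))]).
Proof.
move=> jk pfree; rewrite /angle_sum faces_simplex// fsbig_image; last first.
  by move=> I J _ _; exact: subsimplex_inj.
have -> : [set I : {set 'I_n} | #|I| = l.+1] = [set` face_vertex_sets n l].
  by apply/seteqP; split => I; rewrite /= mem_enum inE => /eqP.
rewrite -fsbig_seq ?enum_uniq// [LHS]big_seq [RHS]big_seq; apply: eq_bigr => I.
rewrite mem_enum inE => /eqP cI.
by rewrite tangent_cone_simplex ?cI// grassmann_angle_cone.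
Qed.

Lemma angle_sum_ge0 k l j (F : set 'rV[R]_k) : 0 <= angle_sum l j F.
Proof. by apply: fsumr_ge0 => G _; rewrite fine_ge0. Qed.

(** Independence of the vectors splits a box into rows, and independence of the coordinates splits
    each row into entries. *)
Lemma gaussian_family_law n k d (T : measurableType d) (P : probability T R)
    (X : 'I_n -> {RV P >-> borel 'rV[R]_k})
    (X_gaussian : forall i : 'I_n, std_gaussian P (X i))
    (X_indep : independent P (fun i : 'I_n => X i)) :
  let M w : bM n k := \matrix_i (X i w : 'rV[R]_k) in
  measurable_fun setT M /\
  forall A, measurable A -> P (M @^-1` A) = gmx n k A.
Proof.
move=> M.
have mM : measurable_fun setT M.
  apply: measurable_fun_mx => i c; rewrite /M; under eq_fun do rewrite mxE.
  exact: (measurableT_comp (measurable_entry 0 c) (measurable_funPT (X i))).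
split => //; apply: gmx_image => // B mB.
pose D i : set (borel 'rV[R]_k) := box (fun _ c => B i c).
have -> : M @^-1` box B = \bigcap_i (X i @^-1` D i).
  apply/seteqP; split => [w Bw i _ i' c|w Dw i c].
    by rewrite (ord1 i'); have := Bw i c; rewrite mxE.
  by have := Dw i Logic.I 0 c; rewrite mxE.
rewrite (X_indep D); last by move=> i; exact: measurable_box.
rewrite -(pair_bigA _ (fun i c => normal_prob 0 1 (B i c)))/=.
apply: eq_bigr => i _; have [Xc Xi] := X_gaussian i.
have -> : X i @^-1` D i = \bigcap_c ((fun w => (X i w : 'rV[R]_k) 0 c) @^-1` B i c).
  apply/seteqP; split => [w Dw c _|w Dw i' c]; first exact: Dw.
  by rewrite (ord1 i'); exact: (Dw c).
by rewrite (Xi (B i))//; apply: eq_bigr => c _; exact: Xc.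
Qed.

End AngleSums.

Theorem theorem4p1 (R : realType) (n k : nat) (hn : (2 <= n)%N)
    (hk : (n <= k + 1)%N)
    (d : measure_display) (T : measurableType d) (P : probability T R)
    (X : 'I_n -> {RV P >-> borel 'rV[R]_k})
    (X_gaussian : forall i : 'I_n, std_gaussian P (X i))
    (X_indep : independent P (fun i : 'I_n => X i))
    (l j : nat) (hl : (l <= n - 2)%N) (hj : (j <= n - 2)%N) :
  ('E_P[fun w => angle_sum l j (conv_hull (fun i : 'I_n => X i w : 'rV[R]_k))]
   = (angle_sum l j
       (conv_hull (fun i : 'I_n => delta_mx 0 i : 'rV[R]_n)))%:E)%E.
Proof.
(* From here [n] is the number of vertices minus one, and [hk] becomes [n <= k]. *)
move: hn hk X X_gaussian X_indep hl hj; case: n => [//|n] hn hk X XG XI hl hj.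
have jn : (j <= n.+1)%N by rewrite (leq_trans hj)// leq_subr.
have nk : (n <= k)%N by rewrite addn1 in hk.
have jk : (j <= k)%N by rewrite (leq_trans hj)// (leq_trans _ nk)// subSS leq_subr.
pose phi (I : {set 'I_n.+1}) (M : borel 'M[R]_(n.+1, k)) : \bar R :=
  gmx k j [set A | meets_cone I ((M : 'M[R]_(n.+1, k)) *m (A : 'M[R]_(k, j)))].
have mphi I : measurable_fun setT (phi I).
  exact: measurable_section1 (@measurable_mulmx_meets R n.+1 I k j).
have phi_fin I M : phi I M \is a fin_num.
  apply: fin_num_measure.
  exact: (measurable_preimage (@measurable_mulmxl R _ _ j M) (@measurable_meets_cone R _ I j)).
have phi0 I M : (0 <= phi I M)%E by exact: measure_ge0.
have [mM lawM] := gaussian_family_law XG XI.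
set M := fun w => _ in mM lawM.
have [N [mN N0 Nfree]] := @affinely_free_ae R n k nk.
have -> : angle_sum l j (conv_hull (fun i : 'I_n.+1 => delta_mx 0 i : 'rV[R]_n.+1)) =
    \sum_(I <- face_vertex_sets n.+1 l) fine (gmx n.+1 j [set A | meets_cone I A]).
  (* The regular simplex is the case of the identity matrix, so the same angle formula covers both
     sides. *)
  have E : \matrix_i (delta_mx 0 i : 'rV[R]_n.+1) = 1%:M.
    by apply/matrixP => i i'; rewrite !mxE eqxx eq_sym.
  rewrite angle_sum_simplex//; last by rewrite E => a _; rewrite mulmx1.
  apply: eq_bigr => I _; congr (fine (gmx n.+1 j _)).
  by apply/seteqP; split => A /=; rewrite E mul1mx.
rewrite unlock.
transitivity (\int[P]_w \sum_(I <- face_vertex_sets n.+1 l) phi I (M w))%E.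
  (* Outside this null event the points are affinely independent and the angle sum equals a
     measurable function of the matrix. *)
  apply: (integral_ae_nonmeasurable (N := M @^-1` N)).
  - by move=> w; rewrite lee_fin angle_sum_ge0.
  - by move=> w; apply: sume_ge0.
  - by apply: emeasurable_sum => I; exact: (measurableT_comp (mphi I) mM).
  - exact: (measurable_preimage mM mN).
  - exact: (etrans (lawM _ mN) N0).
  - move=> w /Nfree Mfree; rewrite angle_sum_simplex// -sumEFin.
    by apply: eq_bigr => I _; rewrite fineK//; exact: phi_fin.
rewrite ge0_integral_sum//; last first.
  by move=> I; exact: (measurableT_comp (mphi I) mM).
rewrite -sumEFin; apply: eq_bigr => I _.
rewrite fineK; last by apply: fin_num_measure; exact: measurable_meets_cone.
rewrite -(average_meets_cone I jk).
transitivity (\int[image_prob P mM]_Y phi I Y)%E.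
  by apply/esym; exact: ge0_integral_distribution.
by apply: eq_measure_integral => A mA _; exact: lawM.
Qed.
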